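(* Let $e,m,n$ be integers with $1\le m<n\le e-2$ and suppose that $\mathbb K[\overline{S(e,m,n)}]$ is Cohen--Macaulay. Then $$\operatorname{reg}_{R(e,m,n)[y]}\left(\mathbb K[\overline{S(e,m,n)}]\right)=\begin{cases}6&\text{if }(e,m,n)=(4,1,2),\\ 4&\text{if }(e,m,n)\in\{(5,1,2),(5,1,3),(5,2,3)\},\\ 3&\text{if }e\ge6\text{ and }m=1,\\ 3&\text{if }e\ge6\text{ and }(m,n)\in\{(2,3),(e-3,e-2),(e-4,e-2)\},\\ 3&\text{if }e\ge6,\ n=e-2\text{ and }2\le m\le e-5,\\ 2&\text{otherwise.}\end{cases}$$
   Context: $\mathbb K$ is an algebraically closed field of characteristic zero. $R(e,m,n)=\mathbb K[\{x_0,\ldots,x_{e-1}\}\setminus\{x_m,x_n\}]$, and $R(e,m,n)[y]$ is standard graded (all variables of degree 1). $\overline{S(e,m,n)}\subseteq\mathbb N^2$ is the affine semigroup generated by $(e+i,\,e-1-i)$ for $i\in\{0,\ldots,e-1\}\setminus\{m,n\}$ together with $(0,2e-1)$. $\mathbb K[\overline{S(e,m,n)}]=R(e,m,n)[y]/I_{\overline{S(e,m,n)}}$, where $I_{\overline{S(e,m,n)}}$ is the (homogeneous) kernel of the $\mathbb K$-algebra homomorphism $R(e,m,n)[y]\to\mathbb K[t_1,t_2]$, $x_i\mapsto t_1^{e+i}t_2^{e-1-i}$, $y\mapsto t_2^{2e-1}$. For a standard graded polynomial ring $Q$ over $\mathbb K$ and a finitely generated graded $Q$-module $M$, the Castelnuovo--Mumford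 regularity is $\operatorname{reg}_Q(M)=\max\{j-i\mid\operatorname{Tor}^Q_i(M,\mathbb K)_j\ne0\}$. *)

(* Defs.v *)
From HB Require Import structures.
From mathcomp Require Import all_boot all_order all_algebra.
From mathcomp Require Import mpoly.

Set Implicit Arguments.
Unset Strict Implicit.
Unset Printing Implicit Defensive.

Import GRing.Theory.
Local Open Scope ring_scope.
Local Open Scope quotient_scope.

(* Ideals are Prop-valued predicates, so that no decidability of membership is
   assumed. *)
Section CohenMacaulay.
Variable A : comNzRingType.

Definition is_ideal (I : A -> Prop) : Prop :=
  [/\ I 0, forall x y, I x -> I y -> I (x + y) & forall a x, I x -> I (a * x)].

Definition is_prime_ideal (P : A -> Prop) : Prop :=
  [/\ is_ideal P, ~ P 1 & forall x y, P (x * y) -> P x \/ P y].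

Definition is_maximal_ideal (P : A -> Prop) : Prop :=
  [/\ is_ideal P, ~ P 1 &
      forall J : A -> Prop, is_ideal J -> (forall x, P x -> J x) -> ~ J 1 ->
        forall x, J x -> P x].

Definition ideal_span (s : seq A) (x : A) : Prop :=
  exists c : 'I_(size s) -> A, x = \sum_(i < size s) c i * s`_i.

Definition is_noetherian : Prop :=
  forall I : A -> Prop, is_ideal I ->
    exists s : seq A, forall x, I x <-> ideal_span s x.

Definition regular_sequence (s : seq A) : Prop :=
  ~ ideal_span s 1 /\
  forall i, (i < size s)%N -> forall a,
    ideal_span (take i s) (s`_i * a) -> ideal_span (take i s) a.

(* The sup of the lengths of the regular sequences contained in P is
   attained and equal to d. *)
Definition ideal_depth (P : A -> Prop) (d : nat) : Prop :=
  (exists s, [/\ regular_sequence s, forall x, x \in s -> P x & size s = d]) /\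
  (forall s, regular_sequence s -> (forall x, x \in s -> P x) ->
     (size s <= d)%N).

Definition prime_chain (P : A -> Prop) (d : nat) (C : nat -> A -> Prop) : Prop :=
  [/\ forall i, (i <= d)%N -> is_prime_ideal (C i),
      forall i, (i < d)%N -> (forall x, C i x -> C i.+1 x) /\
                             (exists2 x, C i.+1 x & ~ C i x)
    & forall x, C d x -> P x].

Definition ideal_height (P : A -> Prop) (d : nat) : Prop :=
  (exists C, prime_chain P d C) /\
  (forall d' C, prime_chain P d' C -> (d' <= d)%N).

(* The global form of the definition (Eisenbud, Commutative Algebra, 18.2):
   depth and codimension agree for every maximal ideal, which avoids
   localizations. *)
Definition Cohen_Macaulay : Prop :=
  is_noetherian /\
  forall P : A -> Prop, is_maximal_ideal P ->
    exists2 d, ideal_depth P d & ideal_height P d.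

End CohenMacaulay.

Section Regularity.
Variables (K : fieldType) (N : nat).
Local Notation Q := {mpoly K[N]}.

(* Homogeneity for the standard grading indexed by the integers; the zero
   polynomial is homogeneous of every degree. *)
Definition homogz (d : int) (p : Q) : bool :=
  match d with Posz c => p \is c.-homog | Negz _ => p == 0 end.

(* A graded Q-module is given by a module M and the family G of its graded
   pieces.  The i-th term of the resolution is the direct sum over k of the
   Q(- fr_deg i k); its elements are row vectors, on which the differentials
   act by right multiplication. *)
Record graded_free_resolution (M : lmodType Q) (G : int -> M -> Prop) := {
  fr_rank : nat -> nat;
  fr_deg : forall i, 'I_(fr_rank i) -> int;
  fr_diff : forall i, 'M[Q]_(fr_rank i.+1, fr_rank i);
  fr_aug : 'I_(fr_rank 0%N) -> M;
  fr_diff_homog : forall i k l,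
    homogz (fr_deg k - fr_deg l) (fr_diff i k l);
  fr_aug_homog : forall k, G (fr_deg k) (fr_aug k);
  fr_aug_surj : forall x : M, exists v : 'rV[Q]_(fr_rank 0%N),
    x = \sum_k v 0 k *: fr_aug k;
  fr_exact0 : forall v : 'rV[Q]_(fr_rank 0%N),
    \sum_k v 0 k *: fr_aug k = 0 <-> exists w, v = w *m fr_diff 0%N;
  fr_exact : forall i (v : 'rV[Q]_(fr_rank i.+1)),
    v *m fr_diff i = 0 <-> exists w, v = w *m fr_diff i.+1
}.

Section Tor.
Variables (M : lmodType Q) (G : int -> M -> Prop).

(* K is Q modulo the ideal of the variables, so tensoring a matrix with K
   keeps the constant terms of its entries. *)
Definition fr_diffK (F : graded_free_resolution G) i :
    'M[K]_(fr_rank F i.+1, fr_rank F i) :=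
  map_mx (mcoeff 0%MM) (fr_diff F i).

Definition fr_cycleK (F : graded_free_resolution G) i :
    'rV[K]_(fr_rank F i) -> Prop :=
  match i with
  | 0 => fun _ => True
  | i'.+1 => fun v => v *m fr_diffK F i' = 0
  end.

Definition homologyK_neq0 (F : graded_free_resolution G) (i : nat) (j : int) :
    Prop :=
  exists v : 'rV[K]_(fr_rank F i),
    [/\ forall k, fr_deg k != j -> v 0 k = 0,
        fr_cycleK v
      & ~ exists w, v = w *m fr_diffK F i].

(* Tor_i^Q(M, K)_j <> 0.  Up to isomorphism Tor does not depend on the
   resolution used to compute it. *)
Definition Tor_neq0 (i : nat) (j : int) : Prop :=
  exists F : graded_free_resolution G, homologyK_neq0 F i j.

Definition has_regularity (r : int) : Prop :=
  (exists i j, Tor_neq0 i j /\ r = j - i%:Z) /\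
  (forall i j, Tor_neq0 i j -> (j - i%:Z <= r)%R).

End Tor.
End Regularity.

Definition xvars (e m n : nat) : seq nat :=
  [seq i <- iota 0 e | (i != m) && (i != n)].

(* Exponents of the images of the variables: those of the x_i in increasing
   order of i, then that of y. *)
Definition Sbar_gens (e m n : nat) : seq (nat * nat) :=
  rcons [seq ((e + i)%N, (e - 1 - i)%N) | i <- xvars e m n]
        (0%N, (2 * e - 1)%N).

Section SemigroupRing.
Variables (K : fieldType) (e m n : nat).

(* R(e,m,n)[y] *)
Local Notation Sbar_poly := {mpoly K[size (Sbar_gens e m n)]}.

Definition Sbar_images : (size (Sbar_gens e m n)).-tuple {mpoly K[2]} :=
  [tuple of [seq 'X_ord0 ^+ g.1 * 'X_ord_max ^+ g.2
            | g <- in_tuple (Sbar_gens e m n)]].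

Definition Sbar_ideal : pred Sbar_poly := fun p => p \mPo Sbar_images == 0.

Lemma Sbar_ideal_closed : idealr_closed Sbar_ideal.
Proof.
split; first by rewrite unfold_in /Sbar_ideal comp_mpoly0.
  by rewrite unfold_in /Sbar_ideal comp_mpoly1 oner_neq0.
move=> a u v; rewrite !unfold_in /Sbar_ideal => /eqP u0 /eqP v0.
by rewrite comp_mpolyD rmorphM /= u0 v0 mulr0 addr0.
Qed.

HB.instance Definition _ :=
  isIdealr.Build Sbar_poly Sbar_ideal Sbar_ideal_closed.

Local Notation I := (Sbar_ideal : idealr Sbar_poly).

Definition Sbar_ring := {ideal_quot I}.
HB.instance Definition _ := GRing.ComNzRing.on Sbar_ring.

Definition Sbar_proj (p : Sbar_poly) : Sbar_ring :=
  \pi_({ideal_quot I}) p.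

Definition Sbar_scale (p : Sbar_poly) (a : Sbar_ring) : Sbar_ring :=
  Sbar_proj p * a.

Fact Sbar_scaleA p q a : Sbar_scale p (Sbar_scale q a) = Sbar_scale (p * q) a.
Proof. by rewrite /Sbar_scale mulrA /Sbar_proj rmorphM. Qed.

Fact Sbar_scale1 : left_id 1 Sbar_scale.
Proof. by move=> a; rewrite /Sbar_scale /Sbar_proj rmorph1 mul1r. Qed.

Fact Sbar_scaleDr : right_distributive Sbar_scale +%R.
Proof. by move=> p a b; rewrite /Sbar_scale mulrDr. Qed.

Fact Sbar_scaleDl a : {morph Sbar_scale^~ a : p q / p + q}.
Proof. by move=> p q; rewrite /Sbar_scale /Sbar_proj rmorphD mulrDl. Qed.

HB.instance Definition _ := GRing.Zmodule_isLmodule.Build Sbar_poly Sbar_ring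
  Sbar_scaleA Sbar_scale1 Sbar_scaleDr Sbar_scaleDl.

Definition Sbar_piece (d : int) (a : Sbar_ring) : Prop :=
  exists2 p : Sbar_poly, homogz d p & a = Sbar_proj p.

End SemigroupRing.

(* Main.v *)
Require Import Defs.
From HB Require Import structures.
From mathcomp Require Import all_boot all_order all_algebra.
From mathcomp Require Import mpoly.
From mathcomp Require Import zify.

Set Implicit Arguments.
Unset Strict Implicit.
Unset Printing Implicit Defensive.

Import Order.TTheory GRing.Theory Num.Theory.
Local Open Scope ring_scope.

(** Write w = 2e-1, A for the semigroup ring, Q for the polynomial ring, and
    y, z for the variables with exponents (0, w) and (w, 0).  All generators of
    the semigroup have coordinate sum w, so an element of degree d is determined
    by its first coordinate a, which ranges over the d-fold sums of the numbers
    0 and e+i (i different from m and n).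

    Cohen-Macaulayness gives a closure property of the semigroup
    ([Sbar_closed_of_CM]): the height of the irrelevant ideal is at least 2, so
    it contains a regular sequence a, b; if a monomial t^s satisfies
    g + s in S for all generators g, then b (a t^s) = a (b t^s) in A forces
    a t^s to be a multiple of a, hence t^s to lie in A.  A pigeonhole argument
    turns this into the usual criterion: if s + (0, w) and s + (w, 0) are in S,
    so is s ([reach_corner]).

    Consequently A is free over B = K[y, z]: for each residue b modulo w, a
    monomial X^(mu b) of least degree whose first coordinate is b modulo w
    belongs to the basis ([apery_basis_exists]).  Then Q over B tensored with A
    is a free Q-module on the same basis, on which every other variable x_j acts
    in two ways, by x_j and by multiplication by its class in A.  The
    differences X_j of the two actions commute and form a regular sequence with
    cokernel A, so that their Koszul complex is a graded free resolution of A
    ([Sbar_resolution]).  Its i-th term is generated in degrees i + deg (mu b),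
    and in the last term every such degree occurs.  Hence the regularity of A is
    the maximum of deg (mu b) ([Sbar_regularity]), provided that Tor can be
    bounded in terms of one resolution only; that is the classical comparison of
    two resolutions ([Tor_degree_le]).

    The maximum of deg (mu b) is the least r for which the r-fold sums meet
    every residue class modulo w, so what remains is elementary
    ([cover2], [cover3], [not_cover1], [not_cover2]).  For e <= 6 the sums are
    listed.  For e >= 7 the triple (e, e-4, e-3) would violate the formula, but
    there A is not Cohen-Macaulay ([CM_excludes]). *)

(** * Homogeneous polynomials in integer degrees *)
Section GradedPolynomials.
Variables (K : fieldType) (N : nat).
Local Notation Q := {mpoly K[N]}.
Implicit Types (p q : Q) (d : int).

Lemma homogz0 d : homogz d (0 : Q).
Proof. by case: d => c /=; rewrite ?eqxx ?dhomog0. Qed.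

Lemma homogzD d p q : homogz d p -> homogz d q -> homogz d (p + q).
Proof.
case: d => c /=; first by move=> hp hq; exact: dhomogD.
by move=> /eqP -> /eqP ->; rewrite addr0.
Qed.

Lemma homogzN d p : homogz d p -> homogz d (- p).
Proof.
case: d => c /=; first by move=> hp; rewrite rpredN.
by move=> /eqP ->; rewrite oppr0.
Qed.

Lemma homogz_sum d (I : finType) (F : I -> Q) :
  (forall i, homogz d (F i)) -> homogz d (\sum_i F i).
Proof.
by move=> h; elim/big_ind: _ => //; [exact: homogz0 | exact: homogzD].
Qed.

Lemma homogzM d1 d2 p q :
  homogz d1 p -> homogz d2 q -> homogz (d1 + d2) (p * q).
Proof.
case: d1 => a; last by move=> /eqP ->; rewrite mul0r homogz0.
case: d2 => b; last by move=> _ /eqP ->; rewrite mulr0 homogz0.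
by rewrite -PoszD; exact: dhomogM.
Qed.

Lemma homogz_mcoeff0 d p : homogz d p -> d != 0 -> p@_0%MM = 0.
Proof.
case: d => c; last by move=> /eqP -> _; rewrite mcoeff0.
move=> hp nz; apply: (dhomog_nemf_coeff hp).
by rewrite /= mdeg0 eq_sym.
Qed.

Definition homog_part d p : Q :=
  match d with Posz c => pihomog mdeg c p | Negz _ => 0 end.

Lemma homog_part_homog d p : homogz d (homog_part d p).
Proof. by case: d => c /=; [exact: pihomogP | exact: eqxx]. Qed.

Lemma homog_part_id d p : homogz d p -> homog_part d p = p.
Proof. by case: d => c /= => [/pihomog_dE|/eqP ->]. Qed.

Lemma homog_partD d p q : homog_part d (p + q) = homog_part d p + homog_part d q.
Proof. by case: d => c /=; rewrite ?addr0 // linearD. Qed.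

Lemma homog_part0 d : homog_part d 0 = 0.
Proof. by case: d => c //=; rewrite linear0. Qed.

Lemma homog_part_sum d (I : finType) (F : I -> Q) :
  homog_part d (\sum_i F i) = \sum_i homog_part d (F i).
Proof. by rewrite (big_morph _ (homog_partD d) (homog_part0 d)). Qed.

Lemma homog_partZ d (c : K) p : homog_part d (c *: p) = c *: homog_part d p.
Proof. by case: d => a /=; rewrite ?scaler0 // linearZ. Qed.

Lemma homog_partX d m : homog_part d 'X_[m] = if (mdeg m : int) == d then 'X_[m] else 0.
Proof. by case: d => a //=; rewrite pihomogX. Qed.

Lemma homog_part_neq d d' p : homogz d p -> d != d' -> homog_part d' p = 0.
Proof.
case: d => c; last by move=> /eqP ->; rewrite homog_part0.
by case: d' => c' //= hp ne; exact: (pihomog_ne0 ne).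
Qed.

(** This is what makes it possible to replace the coefficients of a relation
    between homogeneous elements by their homogeneous components. *)
Lemma homog_partM d d' p q : homogz d' q ->
  homog_part d (p * q) = homog_part (d - d') p * q.
Proof.
move=> hq; elim/mpolyind: p => [|c m p _ _ IH]; first by rewrite mul0r !homog_part0 mul0r.
rewrite mulrDl !homog_partD mulrDl IH; congr (_ + _).
rewrite -scalerAl !homog_partZ -scalerAl homog_partX; congr (_ *: _).
have hX : homogz ((mdeg m)%:Z + d') ('X_[m] * q).
  by apply: homogzM => //=; rewrite dhomogX.
case: eqP => [e|/eqP ne]; last by rewrite mul0r (homog_part_neq hX) //; lia.
by rewrite homog_part_id //; have -> : d = (mdeg m)%:Z + d' by lia.
Qed.

End GradedPolynomials.

(** * Comparison of graded free resolutions *)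
Section Comparison.
Variables (K : fieldType) (N : nat).
Local Notation Q := {mpoly K[N]}.
Variables (M : lmodType Q) (G : int -> M -> Prop).

(** The only consequence of the directness of the grading of M that is used: in a
    relation expressing a homogeneous element through homogeneous elements, the
    coefficients may be replaced by their components of the expected degree. *)
Definition graded_relations := forall n (v : 'I_n -> Q) (dg : 'I_n -> int)
    (x : 'I_n -> M) d y,
  (forall l, G (dg l) (x l)) -> G d y -> \sum_l v l *: x l = y ->
  \sum_l homog_part (d - dg l) (v l) *: x l = y.

Implicit Types F : graded_free_resolution G.

Lemma row_mul_diff F m (A : 'M[Q]_(m, fr_rank F 0)) k :
  \sum_l A k l *: fr_aug l = \sum_l row k A 0 l *: fr_aug l.
Proof. by apply: eq_bigr => l _; rewrite mxE. Qed.

Lemma lift_diff0 F m (A : 'M[Q]_(m, fr_rank F 0)) :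
  (forall k, \sum_l A k l *: fr_aug l = 0) -> exists B, A = B *m fr_diff F 0.
Proof.
move=> h; have /fin_all_exists[B hB] : forall k, exists w, row k A = w *m fr_diff F 0.
  by move=> k; apply/fr_exact0; rewrite -row_mul_diff.
exists (\matrix_k B k); apply/row_matrixP => k.
by rewrite row_mul rowK hB.
Qed.

Lemma lift_diffS F i m (A : 'M[Q]_(m, fr_rank F i.+1)) :
  A *m fr_diff F i = 0 -> exists B, A = B *m fr_diff F i.+1.
Proof.
move=> h; have /fin_all_exists[B hB] :
    forall k, exists w, row k A = w *m fr_diff F i.+1.
  by move=> k; apply/fr_exact; rewrite -row_mul h row0.
exists (\matrix_k B k); apply/row_matrixP => k.
by rewrite row_mul rowK hB.
Qed.

Lemma diff_diff F i : fr_diff F i.+1 *m fr_diff F i = 0.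
Proof.
apply/row_matrixP => k; rewrite row_mul row0; apply/fr_exact.
by exists (delta_mx 0 k); rewrite rowE.
Qed.

Lemma diff_aug F k : \sum_l fr_diff F 0 k l *: fr_aug l = 0.
Proof.
by rewrite row_mul_diff; apply/fr_exact0; exists (delta_mx 0 k); rewrite rowE.
Qed.

Lemma mul_aug F m p (A : 'M[Q]_(m, p)) (B : 'M[Q]_(p, fr_rank F 0)) k :
  \sum_l (A *m B) k l *: fr_aug l =
  \sum_j A k j *: \sum_l B j l *: fr_aug l.
Proof.
under eq_bigr do rewrite mxE scaler_suml.
rewrite exchange_big /=; apply: eq_bigr => j _.
by rewrite scaler_sumr; apply: eq_bigr => l _; rewrite scalerA.
Qed.

Definition homog_map F F' i (phi : 'M[Q]_(fr_rank F i, fr_rank F' i)) :=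
  forall k l, homogz (fr_deg k - fr_deg l) (phi k l).

(** Level i of a comparison: chain maps phi and psi, of which phi is homogeneous,
    and a homotopy h from phi psi to the identity.  The matrix E stands for the
    composite of the previous differential with the previous homotopy.  The
    existence clauses are exactly what is needed to lift phi and psi to level
    i+1, so that the comparison can be built from one level to the next without
    remembering the earlier ones. *)
Definition comparison_step F F' i (phi : 'M[Q]_(fr_rank F i, fr_rank F' i))
    (psi : 'M[Q]_(fr_rank F' i, fr_rank F i))
    (h : 'M[Q]_(fr_rank F i, fr_rank F i.+1)) (E : 'M[Q]_(fr_rank F i)) :=
  [/\ homog_map phi,
      1%:M - phi *m psi = h *m fr_diff F i + E,
      exists phi', fr_diff F i *m phi = phi' *m fr_diff F' i,
      exists psi', fr_diff F' i *m psi = psi' *m fr_diff F i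
    & fr_diff F i *m E = 0 /\
      forall v, fr_cycleK (F := F) v -> v *m map_mx (mcoeff 0%MM) E = 0].

Lemma comparison0 F F' : graded_relations ->
  exists phi psi h E, @comparison_step F F' 0 phi psi h E.
Proof.
move=> rel.
have hphi : forall k, exists v : 'rV[Q]_(fr_rank F' 0),
    fr_aug (g := F) k = \sum_l v 0 l *: fr_aug l /\
    forall l, homogz (fr_deg k - fr_deg l) (v 0 l).
  move=> k; have [v hv] := fr_aug_surj F' (fr_aug (g := F) k).
  exists (\row_l homog_part (fr_deg k - fr_deg l) (v 0 l)).
  split=> [|l]; last by rewrite mxE homog_part_homog.
  have := rel _ (v 0) _ _ _ _ (@fr_aug_homog _ _ _ _ F') (fr_aug_homog k) (esym hv).
  by move=> <-; apply: eq_bigr => l _; rewrite mxE.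
have [f hf] := fin_all_exists hphi.
have hpsi : forall k, exists v : 'rV[Q]_(fr_rank F 0),
    fr_aug (g := F') k = \sum_l v 0 l *: fr_aug l.
  by move=> k; exact: fr_aug_surj.
have [g hg] := fin_all_exists hpsi.
pose phi := \matrix_k f k; pose psi := \matrix_k g k.
have phiE k : \sum_l phi k l *: fr_aug l = fr_aug k.
  by case: (hf k) => -> _; apply: eq_bigr => l _; rewrite mxE.
have psiE k : \sum_l psi k l *: fr_aug l = fr_aug k.
  by rewrite (hg k); apply: eq_bigr => l _; rewrite mxE.
have [h hh] : exists h, 1%:M - phi *m psi = h *m fr_diff F 0.
  apply: lift_diff0 => k; under eq_bigr do rewrite mxE scalerDl.
  rewrite big_split /=.
  under [X in _ + X]eq_bigr do rewrite mxE scaleNr.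
  rewrite sumrN mul_aug; under [X in _ - X]eq_bigr do rewrite psiE.
  rewrite phiE (bigD1 k) //= mxE eqxx scale1r big1 ?addr0 ?subrr // => l ne.
  by rewrite mxE eq_sym (negPf ne) scale0r.
exists phi, psi, h, 0; split.
- by move=> k l; rewrite mxE; case: (hf k).
- by rewrite addr0.
- apply: lift_diff0 => k; rewrite mul_aug; under eq_bigr do rewrite phiE.
  exact: diff_aug.
- apply: lift_diff0 => k; rewrite mul_aug; under eq_bigr do rewrite psiE.
  exact: diff_aug.
- by rewrite mulmx0; split=> // v _; rewrite map_mx0 mulmx0.
Qed.

(** The lift of phi obtained from exactness need not be homogeneous, but its
    entrywise homogeneous part is again a lift, since the differentials and the
    previous phi are homogeneous. *)
Lemma comparisonS F F' i phi psi h E :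
  @comparison_step F F' i phi psi h E ->
  exists phi psi h E, @comparison_step F F' i.+1 phi psi h E.
Proof.
case=> homphi hE [phi' hphi'] [psi' hpsi'] [dE _].
pose f := \matrix_(k, l) homog_part (fr_deg k - fr_deg l) (phi' k l).
have hf : fr_diff F i *m phi = f *m fr_diff F' i.
  apply/matrixP => k l.
  have hom : homogz (fr_deg k - fr_deg l) ((fr_diff F i *m phi) k l).
    rewrite mxE; apply: homogz_sum => j.
    have -> : fr_deg k - fr_deg l = fr_deg k - fr_deg j + (fr_deg j - fr_deg l).
      by lia.
    by apply: homogzM; [exact: fr_diff_homog | exact: homphi].
  rewrite -(homog_part_id hom) hphi' !mxE homog_part_sum; apply: eq_bigr => j _.
  rewrite (homog_partM _ _ (fr_diff_homog _ _)) mxE; congr (homog_part _ _ * _).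
  by lia.
have [h' hh'] : exists h', 1%:M - f *m psi' - fr_diff F i *m h = h' *m fr_diff F i.+1.
  apply: lift_diffS; rewrite !mulmxBl mul1mx -!mulmxA -hpsi' !mulmxA -hf.
  rewrite -[X in X - _ - _]mulmx1 -!mulmxA -!mulmxBr hE addrC addKr.
  exact: dE.
exists f, psi', h', (fr_diff F i *m h); split.
- by move=> k l; rewrite mxE homog_part_homog.
- by rewrite -hh' subrK.
- by apply: lift_diffS; rewrite -mulmxA -hf mulmxA diff_diff mul0mx.
- by apply: lift_diffS; rewrite -mulmxA -hpsi' mulmxA diff_diff mul0mx.
- split; first by rewrite mulmxA diff_diff mul0mx.
  move=> v hv; rewrite map_mxM mulmxA.
  by apply: etrans (mul0mx _ _); congr (_ *m _); exact: hv.
Qed.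

Lemma comparison F F' i : graded_relations ->
  exists phi psi h E, @comparison_step F F' i phi psi h E.
Proof.
move=> rel; elim: i => [|i [phi [psi [h [E /comparisonS]]]] //].
exact: comparison0.
Qed.

(** A cycle of degree j > i + r is killed by phi modulo the variables, because the
    constant terms of the entries of phi vanish unless source and target degrees
    agree; the homotopy then exhibits it as a boundary. *)
Lemma Tor_degree_le F' (r : int) : graded_relations ->
  (forall i (k : 'I_(fr_rank F' i)), fr_deg k <= i%:Z + r) ->
  forall i j, Tor_neq0 G i j -> j - i%:Z <= r.
Proof.
move=> rel bnd i j [F [v [supp cyc nbd]]].
have [phi [psi [h [E [hom hE _ _ [_ cE]]]]]] := comparison F F' i rel.
rewrite leNgt; apply/negP => lt; apply: nbd.
pose ev m n (A : 'M[Q]_(m, n)) := map_mx (mcoeff (0%MM : 'X_{1..N})) A.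
have vphi : v *m ev _ _ phi = 0.
  apply/rowP => l; rewrite !mxE big1 // => k _; rewrite mxE.
  have [e|ne] := eqVneq (fr_deg k) j; last by rewrite supp // mul0r.
  rewrite (homogz_mcoeff0 (hom k l)) ?mulr0 //.
  by rewrite e; have := bnd _ l; lia.
exists (v *m ev _ _ h); rewrite -mulmxA -[fr_diffK F i]/(ev _ _ _) /ev -map_mxM.
have -> : h *m fr_diff F i = 1%:M - phi *m psi - E by rewrite hE addrK.
rewrite !map_mxB map_mx1 map_mxM !mulmxBr mulmx1 mulmxA vphi mul0mx subr0.
by rewrite cE // subr0.
Qed.

(** A basis element of the largest allowed degree in the last term is a cycle
    modulo the variables, for degree reasons, and there is nothing it could be
    the boundary of. *)
Lemma regularity_of_resolution F (r : int) p (k0 : 'I_(fr_rank F p)) :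
  graded_relations ->
  (forall i (k : 'I_(fr_rank F i)), fr_deg k <= i%:Z + r) ->
  fr_deg k0 = p%:Z + r -> fr_rank F p.+1 = 0 ->
  has_regularity G r.
Proof.
move=> rel bnd dk0 r0; split; last exact: Tor_degree_le bnd.
exists p, (p%:Z + r); split; last by lia.
exists F, (delta_mx 0 k0); split.
- move=> k ne; rewrite mxE /= (_ : k == k0 = false) //.
  by apply: contraNF ne => /eqP ->; rewrite dk0.
- case: p k0 dk0 {r0} => [|p] k0 dk0 //=.
  rewrite -rowE; apply/rowP => l; rewrite !mxE.
  apply: (homogz_mcoeff0 (fr_diff_homog k0 l)).
  by have := bnd _ l; rewrite dk0; lia.
- case=> w hw; have := congr1 (fun A : 'rV_ _ => A 0 k0) hw.
  rewrite !mxE !eqxx /= big1 => [/eqP|[s hs] _]; first by rewrite oner_eq0.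
  by exfalso; rewrite r0 in hs.
Qed.

End Comparison.
(** * The Koszul complex of commuting operators *)
Section Koszul.
Variables (K : fieldType) (N w : nat) (T : Type).
Local Notation Q := {mpoly K[N]}.
Variables (delta : 'I_w -> int) (X : T -> 'M[Q]_w).

(** A complex of free modules together with lifts [oc_op] of a family of operators
    to all its terms; [oc_aug] maps its 0-th term to the free module Q^w on which
    the operators act originally.  Keeping the lifts makes the mapping cone of
    one operator again such a complex. *)
Record operator_complex := OperatorComplex {
  oc_rank : nat -> nat;
  oc_deg : forall i, 'I_(oc_rank i) -> int;
  oc_diff : forall i, 'M[Q]_(oc_rank i.+1, oc_rank i);
  oc_aug : 'M[Q]_(oc_rank 0, w);
  oc_op : T -> forall i, 'M[Q]_(oc_rank i)
}.

(** The complex is a graded resolution of Q^w / L, and the lifts are homogeneous of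
    degree 1, commute with each other and are chain maps over the operators X. *)
Record resolves (L : 'rV[Q]_w -> Prop) (C : operator_complex) : Prop := {
  oc_diff_homog : forall i k l,
    homogz (oc_deg k - oc_deg l) (oc_diff C i k l);
  oc_op_homog : forall t i k l,
    homogz (oc_deg k + 1 - oc_deg l) (oc_op C t i k l);
  oc_aug_homog : forall k l, homogz (oc_deg k - delta l) (oc_aug C k l);
  oc_opC : forall s t i, oc_op C s i *m oc_op C t i = oc_op C t i *m oc_op C s i;
  oc_op_diff : forall t i,
    oc_diff C i *m oc_op C t i = oc_op C t i.+1 *m oc_diff C i;
  oc_op_aug : forall t, oc_op C t 0 *m oc_aug C = oc_aug C *m X t;
  oc_aug_surj : exists B, B *m oc_aug C = 1%:M;
  oc_exact0 : forall v, L (v *m oc_aug C) <-> exists u, v = u *m oc_diff C 0;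
  oc_exact : forall i (v : 'rV[Q]_(oc_rank C i.+1)),
    v *m oc_diff C i = 0 <-> exists u, v = u *m oc_diff C i.+1
}.

Definition free_rank i := if i is 0 then w else 0%N.

Definition free_complex : operator_complex := {|
  oc_rank := free_rank;
  oc_deg i := match i return 'I_(free_rank i) -> int with
              | 0 => delta | _ => fun _ => 0 end;
  oc_diff i := 0;
  oc_aug := 1%:M : 'M_(free_rank 0, w);
  oc_op t i := match i return 'M[Q]_(free_rank i) with
               | 0 => X t | _ => 0 end
|}.

Section Cone.
Variables (C : operator_complex) (t : T).

Definition cone_rank i :=
  if i is i'.+1 then (oc_rank C i'.+1 + oc_rank C i')%N else oc_rank C 0.

Definition cone_deg i : 'I_(cone_rank i) -> int :=
  match i return 'I_(cone_rank i) -> int with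
  | 0 => fun k => oc_deg k
  | i'.+1 => fun k => match split k with
                      | inl a => oc_deg a
                      | inr b => oc_deg b + 1
                      end
  end.

Definition cone_diff i : 'M[Q]_(cone_rank i.+1, cone_rank i) :=
  match i return 'M[Q]_(cone_rank i.+1, cone_rank i) with
  | 0 => col_mx (oc_diff C 0) (oc_op C t 0)
  | i'.+1 => block_mx (oc_diff C i'.+1) 0 (oc_op C t i'.+1) (- oc_diff C i')
  end.

Definition cone_op s i : 'M[Q]_(cone_rank i) :=
  match i return 'M[Q]_(cone_rank i) with
  | 0 => oc_op C s 0
  | i'.+1 => block_mx (oc_op C s i'.+1) 0 0 (oc_op C s i')
  end.

Definition cone : operator_complex := {|
  oc_rank := cone_rank; oc_deg := cone_deg; oc_diff := cone_diff;
  oc_aug := oc_aug C; oc_op := cone_op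
|}.

Variable L : 'rV[Q]_w -> Prop.
Hypothesis resC : resolves L C.

Let dd0 i : oc_diff C i.+1 *m oc_diff C i = 0.
Proof.
apply/row_matrixP => k; rewrite row_mul row0; apply/(oc_exact resC).
by exists (delta_mx 0 k); rewrite rowE.
Qed.

(** If X t is injective on Q^w / L, the mapping cone of its lift resolves
    Q^w / (L + im (X t)). *)
Lemma cone_resolves : (forall v, L (v *m X t) -> L v) ->
  resolves (fun v => exists u, L (v - u *m X t)) cone.
Proof.
move=> reg; split.
- case=> [|i] k l /=.
    rewrite mxE; case: (split k) => a; first exact: (oc_diff_homog resC).
    exact: (oc_op_homog resC).
  rewrite !mxE; case: (split k) => a; rewrite !mxE; case: (split l) => b.
  + exact: (oc_diff_homog resC).
  + by rewrite mxE homogz0.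
  + exact: (oc_op_homog resC).
  + rewrite mxE; apply: homogzN; rewrite opprD addrACA subrr addr0.
    exact: (oc_diff_homog resC).
- move=> s [|i] k l /=; first exact: (oc_op_homog resC).
  rewrite !mxE; case: (split k) => a; rewrite !mxE; case: (split l) => b.
  + exact: (oc_op_homog resC).
  + by rewrite mxE homogz0.
  + by rewrite mxE homogz0.
  + rewrite opprD addrACA subrr addr0 -[X in homogz X _]/(_ - _).
    exact: (oc_op_homog resC).
- exact: (oc_aug_homog resC).
- move=> s1 s2 [|i] /=; first exact: (oc_opC resC).
  rewrite !mulmx_block !mul0mx !mulmx0 !addr0 !add0r.
  by rewrite !(oc_opC resC s1).
- move=> s [|i] /=.
    rewrite mul_col_mx mul_block_col !mul0mx addr0 add0r.
    by rewrite (oc_op_diff resC) (oc_opC resC).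
  rewrite !mulmx_block !mul0mx !mulmx0 !addr0 !add0r mulNmx mulmxN.
  by rewrite !(oc_op_diff resC) (oc_opC resC).
- exact: (oc_op_aug resC).
- exact: (oc_aug_surj resC).
- move=> v; have [B hB] := oc_aug_surj resC; split=> [[u]|[u ->]].
    have -> : v *m oc_aug C - u *m X t =
        (v - u *m B *m oc_op C t 0) *m oc_aug C.
      by rewrite mulmxBl -!mulmxA (oc_op_aug resC) (mulmxA B) hB mul1mx.
    move/(oc_exact0 resC) => [x hx]; exists (row_mx x (u *m B)) => /=.
    by rewrite mul_row_col -hx subrK.
  exists (rsubmx u *m oc_aug C) => /=.
  rewrite -{1}(hsubmxK u) mul_row_col mulmxDl -!mulmxA (oc_op_aug resC) addrK.
  by rewrite mulmxA; apply/(oc_exact0 resC); exists (lsubmx u).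
- case=> [|i] v /=; split=> [|[u ->]].
  + rewrite -{1}(hsubmxK v) mul_row_col => e.
    have [c hc] : exists c, rsubmx v = c *m oc_diff C 0.
      apply/(oc_exact0 resC)/reg; rewrite -mulmxA -(oc_op_aug resC) mulmxA.
      apply/(oc_exact0 resC); exists (- lsubmx v).
      by apply/eqP; rewrite mulNmx -subr_eq0 opprK addrC e.
    have [z hz] : exists z, lsubmx v + c *m oc_op C t 1 = z *m oc_diff C 1.
      apply/(oc_exact resC).
      by rewrite mulmxDl -mulmxA -(oc_op_diff resC) mulmxA -hc.
    exists (row_mx z (- c)); rewrite mul_row_block mulmx0 add0r !mulNmx mulmxN opprK.
    by rewrite -hz -hc addrK hsubmxK.
  + rewrite -mulmxA mul_block_col dd0 mul0mx addr0 mulNmx.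
    by rewrite (oc_op_diff resC) subrr col_mx0 mulmx0.
  + rewrite -{1}(hsubmxK v) mul_row_block mulmx0 add0r mulmxN.
    rewrite -row_mx0 => /eq_row_mx[e /eqP].
    rewrite oppr_eq0 => /eqP /(oc_exact resC)[c hc].
    have [z hz] : exists z, lsubmx v + c *m oc_op C t i.+2 = z *m oc_diff C i.+2.
      apply/(oc_exact resC).
      by rewrite mulmxDl -mulmxA -(oc_op_diff resC) mulmxA -hc.
    exists (row_mx z (- c)); rewrite mul_row_block mulmx0 add0r !mulNmx mulmxN opprK.
    by rewrite -hz -hc addrK hsubmxK.
  + rewrite -mulmxA mulmx_block !dd0 !mulmx0 !mul0mx !addr0 add0r.
    rewrite !mulNmx mulmxN opprK dd0 (oc_op_diff resC) subrr.
    by rewrite block_mx0 mulmx0.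
Qed.

End Cone.

Fixpoint koszul (s : seq T) : operator_complex :=
  if s is t :: s' then cone (koszul s') t else free_complex.

Fixpoint op_span (s : seq T) (v : 'rV[Q]_w) : Prop :=
  if s is t :: s' then exists u, op_span s' (v - u *m X t) else v = 0.

Fixpoint op_regular (s : seq T) : Prop :=
  if s is t :: s' then
    (forall v, op_span s' (v *m X t) -> op_span s' v) /\ op_regular s'
  else True.

Hypothesis X_homog : forall t k l, homogz (delta k + 1 - delta l) (X t k l).
Hypothesis XC : forall s t, X s *m X t = X t *m X s.

Lemma free_complex_resolves : resolves (eq^~ 0) free_complex.
Proof.
split=> /=.
- by move=> i k l; rewrite mxE homogz0.
- by move=> t [|i] k l; [exact: X_homog | case: k].
- move=> k l; rewrite mxE; case: eqP => [->|_]; last by rewrite homogz0.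
  by rewrite subrr /= dhomog1.
- by move=> s t [|i] /=; rewrite ?mulmx0.
- by move=> t i; rewrite mul0mx mulmx0.
- by move=> t; rewrite mulmx1 mul1mx.
- by exists 1%:M; rewrite mulmx1.
- move=> v; rewrite mulmx1; split=> [->|[u ->]]; last by rewrite mulmx0.
  by exists 0; rewrite mulmx0.
- move=> i v; rewrite mulmx0; split=> // _; exists 0.
  by apply/rowP; case.
Qed.

Lemma koszul_resolves s : op_regular s -> resolves (op_span s) (koszul s).
Proof.
elim: s => [|t s IH] /=; first by move=> _; exact: free_complex_resolves.
by case=> reg /IH res; exact: cone_resolves.
Qed.

Lemma koszul_rank_gt s i : (size s < i)%N -> oc_rank (koszul s) i = 0.
Proof.
elim: s i => [|t s IH] [|i] //= lt.
by rewrite !IH //; exact: ltnW.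
Qed.

Lemma koszul_deg_le (r : int) s : (forall b, delta b <= r) ->
  forall i (k : 'I_(oc_rank (koszul s) i)), oc_deg k <= i%:Z + r.
Proof.
move=> le_r; elim: s => [|t s IH] [|i] k /=.
- by rewrite add0r; exact: le_r.
- by case: k.
- exact: IH.
- case: (split k) => a; first exact: IH.
  by have := IH _ a; lia.
Qed.

Lemma koszul_deg_top b s :
  exists k : 'I_(oc_rank (koszul s) (size s)), oc_deg k = (size s)%:Z + delta b.
Proof.
elim: s => [|t s [k hk]] /=; first by exists b; rewrite add0r.
exists (rshift _ k); rewrite /cone_deg; case: splitP => j /= e.
  by have := ltn_ord j; rewrite -e -[X in (_ < X)%N]addn0 ltn_add2l.
have -> : j = k by apply/val_inj; apply: (addnI (esym e)).
by rewrite hk; lia.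
Qed.

End Koszul.
(** * Operators with monomial entries *)
Lemma scalarB_mxC (R : comNzRingType) w (a b : R) (A B : 'M[R]_w) :
  A *m B = B *m A -> (a%:M - A) *m (b%:M - B) = (b%:M - B) *m (a%:M - A).
Proof.
move=> AB; rewrite !mulmxBl !mulmxBr AB !mul_scalar_mx !mul_mx_scalar.
rewrite !scale_scalar_mx (mulrC b a) !opprB -!addrA; congr (_ + _).
by rewrite addrCA [RHS]addrCA; congr (_ + _); rewrite addrC.
Qed.

Section MonomialOperators.
Variables (K : fieldType) (N w : nat).
Local Notation Q := {mpoly K[N]}.
Variables (tgt : 'I_N -> 'I_w -> 'I_w) (mon : 'I_N -> 'I_w -> 'X_{1..N}).
Implicit Types (v : 'rV[Q]_w) (s : seq 'I_N).

(** Multiplication by the class of x_j on a monomial basis: it sends the basis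
    element b to the monomial [mon j b] times the basis element [tgt j b]. *)
Definition mon_mx (j : 'I_N) : 'M[Q]_w :=
  \matrix_(b, c) ('X_[mon j b] *+ (c == tgt j b)).

Definition mon_op (j : 'I_N) : 'M[Q]_w := ('X_j : Q)%:M - mon_mx j.

Lemma mon_opC i j :
  (forall b, tgt i (tgt j b) = tgt j (tgt i b)) ->
  (forall b, (mon j b + mon i (tgt j b) = mon i b + mon j (tgt i b))%MM) ->
  mon_op i *m mon_op j = mon_op j *m mon_op i.
Proof.
move=> tC mC.
have mulE k l b d : (mon_mx k *m mon_mx l) b d =
    'X_[mon k b + mon l (tgt k b)] *+ (d == tgt l (tgt k b)).
  rewrite mxE (bigD1 (tgt k b)) //= !mxE eqxx mulr1n mulrnAr -mpolyXD.
  rewrite big1 ?addr0 // => a ne.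
  by rewrite !mxE (negPf ne) mul0r.
have mxC : mon_mx i *m mon_mx j = mon_mx j *m mon_mx i.
  by apply/matrixP => b d; rewrite !mulE tC mC.
exact: scalarB_mxC.
Qed.

Lemma mon_op_homog (delta : 'I_w -> nat) :
  (forall j b, mdeg (mon j b) + delta (tgt j b) = delta b + 1)%N ->
  forall j b c, homogz ((delta b)%:Z + 1 - (delta c)%:Z) (mon_op j b c).
Proof.
move=> hd j b c; rewrite !mxE; apply: homogzD.
  case: eqP => [->|_]; last by rewrite mulr0n homogz0.
  by rewrite mulr1n addrAC subrr add0r /= dhomogX /= mdeg1.
apply: homogzN; case: eqP => [->|_]; last by rewrite mulr0n homogz0.
rewrite mulr1n; have -> : (delta b)%:Z + 1 - (delta (tgt j b))%:Z = mdeg (mon j b).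
  by have := hd j b; lia.
by rewrite /= dhomogX.
Qed.

Local Notation span := (op_span mon_op).

Lemma op_span0 s : span s 0.
Proof. by elim: s => //= t s IH; exists 0; rewrite mul0mx subr0. Qed.

Lemma op_spanD s u v : span s u -> span s v -> span s (u + v).
Proof.
elim: s u v => [|t s IH] u v /=; first by move=> -> ->; rewrite addr0.
case=> a ha [b hb]; exists (a + b); rewrite mulmxDl opprD addrACA.
exact: IH.
Qed.

Lemma op_spanZ s p v : span s v -> span s (p *: v).
Proof.
elim: s v => [|t s IH] v /=; first by move=> ->; rewrite scaler0.
by case=> a ha; exists (p *: a); rewrite -scalemxAl -scalerBr; exact: IH.
Qed.

Lemma op_span_mem s j u : j \in s -> span s (u *m mon_op j).
Proof.
elim: s => //= t s IH; rewrite inE => /orP[/eqP ->|hj].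
  by exists u; rewrite subrr; exact: op_span0.
by exists 0; rewrite mul0mx subr0; exact: IH.
Qed.

Definition vfree s v :=
  forall b (m : 'X_{1..N}) j, j \in s -> m j != 0%N -> (v 0 b)@_m = 0.

Definition reducible s v := exists v', span s (v - v') /\ vfree s v'.

Lemma reducibleD s u v : reducible s u -> reducible s v -> reducible s (u + v).
Proof.
move=> [u' [hu fu]] [v' [hv fv]]; exists (u' + v'); split.
  by rewrite opprD addrACA; exact: op_spanD.
by move=> b m j hj nz; rewrite !mxE mcoeffD (fu _ _ j) // (fv _ _ j) // addr0.
Qed.

Lemma reducibleZ s (a : K) v : reducible s v -> reducible s (a%:MP *: v).
Proof.
move=> [v' [hv fv]]; exists (a%:MP *: v'); split.
  by rewrite -scalerBr; exact: op_spanZ.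
by move=> b m j hj nz; rewrite !mxE mul_mpolyC mcoeffZ (fv _ _ j) // mulr0.
Qed.

Lemma reducible_sum s (I : Type) (r : seq I) (P : pred I) (F : I -> 'rV[Q]_w) :
  (forall i, P i -> reducible s (F i)) -> reducible s (\sum_(i <- r | P i) F i).
Proof.
move=> h; elim/big_ind: _ => //; last exact: reducibleD.
exists 0; split; first by rewrite subr0; exact: op_span0.
by move=> *; rewrite mxE mcoeff0.
Qed.

Lemma delta_mon_op (m : 'X_{1..N}) b j :
  ('X_[m] *: delta_mx 0 b : 'rV[Q]_w) *m mon_op j =
  'X_[m + U_(j)] *: delta_mx 0 b - 'X_[m + mon j b] *: delta_mx 0 (tgt j b).
Proof.
rewrite mulmxBr -!scalemxAl mul_mx_scalar scalerA -mpolyXD; congr (_ - _).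
rewrite mpolyXD -scalerA; congr (_ *: _); rewrite -rowE.
by apply/rowP => c; rewrite !mxE eqxx /= mulr_natr.
Qed.

(** Modulo the image of X_j, a factor x_j may be traded for [mon j b], which is
    free of the variables in s; this lowers the total degree in those variables. *)
Lemma reducible_monomial s :
  (forall j l b, j \in s -> l \in s -> mon j b l = 0%N) ->
  forall m b, reducible s ('X_[m] *: delta_mx 0 b).
Proof.
move=> mons m b; have [k] := ubnP (\sum_(l <- s) m l)%N.
elim: k m b => // k IH m b lek.
have [/hasP[j js nz]|] := boolP (has (fun j => m j != 0%N) s); last first.
  move/hasPn => h; exists ('X_[m] *: delta_mx 0 b).
  split; first by rewrite subrr; exact: op_span0.
  move=> c m' j hj nz; rewrite !mxE eqxx /= mulr_natr mcoeffMn mcoeffX.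
  have -> : (m == m') = false.
    by apply: contraNF nz => /eqP <-; have := h _ hj; rewrite negbK.
  by rewrite mul0rn.
pose m' := (m - U_(j))%MM.
have em : m = (m' + U_(j))%MM by rewrite submK // lep1mP.
have /IH : (\sum_(l <- s) (m' + mon j b)%MM l < k)%N.
  rewrite ltnS in lek; apply: leq_trans lek.
  apply: (@leq_trans (\sum_(l <- s) m' l).+1).
    rewrite ltnS big_seq [leqRHS]big_seq; apply: leq_sum => l hl.
    by rewrite mnmDE mons // addn0.
  rewrite em; under [leqRHS]eq_bigr do rewrite mnmDE.
  rewrite big_split /= -addn1 leq_add2l.
  by rewrite (big_rem j) //= mnm1E eqxx.
move=> /(_ (tgt j b)) red.
rewrite em; have -> : 'X_[m' + U_(j)] *: delta_mx 0 b =
    ('X_[m'] *: delta_mx 0 b) *m mon_op j +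
    ('X_[m' + mon j b] *: delta_mx 0 (tgt j b) : 'rV[Q]_w).
  by rewrite delta_mon_op subrK.
apply: reducibleD => //; exists 0; split; first by rewrite subr0; exact: op_span_mem.
by move=> *; rewrite mxE mcoeff0.
Qed.

Lemma reducible_all s :
  (forall j l b, j \in s -> l \in s -> mon j b l = 0%N) ->
  forall v, reducible s v.
Proof.
move=> mons v; rewrite (row_sum_delta v); apply: reducible_sum => b _.
rewrite [v 0 b]mpolyE scaler_suml; apply: reducible_sum => m _.
rewrite -mul_mpolyC -scalerA; apply: reducibleZ; exact: reducible_monomial.
Qed.

Section Evaluation.
Variables (D : nat) (H : 'I_N -> 'X_{1..D}) (G : 'I_w -> 'X_{1..D}).

Definition img_exp (m : 'X_{1..N}) : 'X_{1..D} := (\sum_l H l *+ m l)%MM.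

Lemma img_expE m i : img_exp m i = (\sum_l H l i * m l)%N.
Proof. by rewrite mnm_sumE; apply: eq_bigr => l _; rewrite mulmnE. Qed.

Definition mon_eval (p : Q) : {mpoly K[D]} := p \mPo [tuple 'X_[H l] | l < N].

Lemma mon_evalB p q : mon_eval (p - q) = mon_eval p - mon_eval q.
Proof. exact: rmorphB. Qed.

Lemma mon_evalM p q : mon_eval (p * q) = mon_eval p * mon_eval q.
Proof. exact: rmorphM. Qed.

Lemma mon_evalMn p n : mon_eval (p *+ n) = mon_eval p *+ n.
Proof. exact: rmorphMn. Qed.

Lemma mon_evalZ c p : mon_eval (c *: p) = c *: mon_eval p.
Proof. exact: comp_mpolyZ. Qed.

Lemma mon_eval_sum (I : Type) (r : seq I) (F : I -> Q) :
  mon_eval (\sum_(i <- r) F i) = \sum_(i <- r) mon_eval (F i).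
Proof. exact: rmorph_sum. Qed.

Lemma mon_evalX m : mon_eval 'X_[m] = 'X_[img_exp m].
Proof.
rewrite /mon_eval comp_mpolyX /img_exp -mprodXnE; apply: eq_bigr => l _.
by rewrite tnth_mktuple.
Qed.

Lemma mon_evalXU j : mon_eval 'X_j = 'X_[H j].
Proof.
rewrite mon_evalX; congr mpolyX; apply/mnmP => i; rewrite img_expE (bigD1 j) //=.
rewrite mnm1E eqxx muln1 big1 ?addn0 // => l ne.
by rewrite mnm1E eq_sym (negPf ne) muln0.
Qed.

Definition vec_eval v : {mpoly K[D]} := \sum_b mon_eval (v 0 b) * 'X_[G b].

Lemma vec_evalB u v : vec_eval (u - v) = vec_eval u - vec_eval v.
Proof.
rewrite /vec_eval -sumrB; apply: eq_bigr => b _.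
by rewrite !mxE mon_evalB mulrBl.
Qed.

Lemma vec_eval0 : vec_eval 0 = 0.
Proof. by rewrite -(subrr 0) vec_evalB subrr. Qed.

Lemma vec_eval_op j v E :
  (forall b, (img_exp (mon j b) + G (tgt j b) = E + G b)%MM) ->
  vec_eval (v *m mon_op j) = ('X_[H j] - 'X_[E]) * vec_eval v.
Proof.
move=> hE; rewrite /vec_eval mulr_sumr.
under eq_bigr do rewrite mxE mon_eval_sum mulr_suml.
rewrite exchange_big /=; apply: eq_bigr => b _.
under eq_bigr do rewrite mon_evalM -mulrA.
rewrite -mulr_sumr mulrCA; congr (_ * _).
under eq_bigr do rewrite !mxE mon_evalB !mon_evalMn mulrBl mon_evalXU mon_evalX.
rewrite sumrB mulrBl; congr (_ - _).
  rewrite (bigD1 b) //= eqxx mulr1n big1 ?addr0 // => c ne.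
  by rewrite eq_sym (negPf ne) mulr0n mul0r.
rewrite (bigD1 (tgt j b)) //= eqxx mulr1n -mpolyXD hE mpolyXD.
by rewrite big1 ?addr0 // => c ne; rewrite (negPf ne) mulr0n mul0r.
Qed.

Variable s : seq 'I_N.
Hypothesis mon_H : forall j b, j \in s ->
  (img_exp (mon j b) + G (tgt j b) = H j + G b)%MM.
Hypothesis mon_free : forall j l b, j \in s -> l \in s -> mon j b l = 0%N.
Hypothesis H_inj : forall b b' (m m' : 'X_{1..N}),
  (forall j, j \in s -> m j = 0%N) -> (forall j, j \in s -> m' j = 0%N) ->
  (img_exp m + G b = img_exp m' + G b')%MM -> b = b' /\ m = m'.

(** Vectors free of the variables in s are combinations of pairs (monomial, basis
    element), and evaluation maps these pairs to distinct monomials. *)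
Lemma vec_eval_free_inj v : vfree s v -> vec_eval v = 0 -> v = 0.
Proof.
move=> fv ev0; apply/rowP => b0; rewrite mxE; apply/mpolyP => m0; rewrite mcoeff0.
apply/eqP; rewrite mcoeff_eq0; apply/negP => hm0.
have frm b m : m \in msupp (v 0 b) -> forall j, j \in s -> m j = 0%N.
  move=> hm j hj; apply/eqP; apply: contraTT hm => nz.
  by rewrite -mcoeff_eq0 (fv _ _ _ hj nz).
have := congr1 (mcoeff (img_exp m0 + G b0)%MM) ev0.
have expand b : mon_eval (v 0 b) * 'X_[G b] =
    \sum_(m <- msupp (v 0 b)) (v 0 b)@_m *: 'X_[img_exp m + G b].
  rewrite {1}[v 0 b]mpolyE mon_eval_sum mulr_suml; apply: eq_bigr => m _.
  by rewrite mon_evalZ -scalerAl mon_evalX -mpolyXD.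
rewrite /vec_eval mcoeff0 raddf_sum (bigD1 b0) //= [X in _ + X]big1; last first.
  move=> b ne; rewrite expand raddf_sum big_seq big1 // => m hm /=.
  rewrite mcoeffZ mcoeffX; case: eqP => [e|]; last by rewrite mulr0.
  by have [eb _] := H_inj (frm _ _ hm) (frm _ _ hm0) e; rewrite eb eqxx in ne.
rewrite addr0 expand raddf_sum (bigD1_seq m0) ?msupp_uniq //= mcoeffZ mcoeffX eqxx.
rewrite mulr1 big_seq_cond big1; last first.
  move=> m /andP[hm ne]; rewrite mcoeffZ mcoeffX; case: eqP => [e|]; last by rewrite mulr0.
  by have [_ em] := H_inj (frm _ _ hm) (frm _ _ hm0) e; rewrite em eqxx in ne.
by move/eqP; rewrite addr0 mcoeff_eq0 hm0.
Qed.

(** The quotient of Q^w by the operators in s embeds into a polynomial ring,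
    because reduced vectors are determined by their values. *)
Lemma op_span_vec_eval v : span s v <-> vec_eval v = 0.
Proof.
have fwd : forall s' u, {subset s' <= s} -> span s' u -> vec_eval u = 0.
  elim=> [|t s' IH] u sub /=; first by move=> ->; exact: vec_eval0.
  case=> a /IH; rewrite vec_evalB (@vec_eval_op _ _ (H t)); last first.
    by move=> b; apply: mon_H; apply: sub; rewrite mem_head.
  rewrite subrr mul0r subr0; apply=> l hl.
  by apply: sub; rewrite inE hl orbT.
split; first by apply: fwd.
move=> ev0; have [v' [hs fv]] := reducible_all mon_free v.
suff v0 : v' = 0 by rewrite v0 subr0 in hs.
apply: vec_eval_free_inj => //.
have := fwd _ _ (fun l h => h) hs.
by rewrite vec_evalB ev0 sub0r => /eqP; rewrite oppr_eq0 => /eqP.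
Qed.

(** On the image of that embedding, the next operator is multiplication by a
    nonzero binomial, and the target is a domain. *)
Lemma mon_op_regular j E :
  (forall b, (img_exp (mon j b) + G (tgt j b) = E + G b)%MM) -> H j != E ->
  forall v, span s (v *m mon_op j) -> span s v.
Proof.
move=> hE ne v /op_span_vec_eval; rewrite (vec_eval_op _ hE) => /eqP.
rewrite mulf_eq0 => /orP[|/eqP h]; last exact/op_span_vec_eval.
rewrite subr_eq0 => /eqP /(congr1 (mcoeff E)) /eqP.
by rewrite !mcoeffX (negPf ne) eqxx eq_sym oner_eq0.
Qed.

End Evaluation.
End MonomialOperators.
(** * Monomial bases over K[y, z] *)
Section Apery.
Variables (N w : nat) (g : 'I_N -> nat * nat) (y z : 'I_N).

Definition weight (m : 'X_{1..N}) : nat * nat :=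
  ((\sum_l (g l).1 * m l)%N, (\sum_l (g l).2 * m l)%N).

Lemma weight_mdeg m : (forall j, (g j).1 + (g j).2 = w)%N ->
  ((weight m).1 + (weight m).2 = mdeg m * w)%N.
Proof.
move=> gw; rewrite /weight /= -big_split /= mdegE big_distrl /=.
by apply: eq_bigr => l _; rewrite -mulnDl gw mulnC.
Qed.

(** The monomials of exponents [mu b] represent the residues b modulo w, and the
    product of x_j with such a monomial is y^(p j b) z^(q j b) times another one.
    Both exponent equations are recorded, whence the same for degrees. *)
Record apery_basis (mu : 'I_w -> 'X_{1..N}) (tgt : 'I_N -> 'I_w -> 'I_w)
    (p q : 'I_N -> 'I_w -> nat) : Prop := {
  ap_w : (0 < w)%N;
  ap_y : g y = (0, w)%N;
  ap_z : g z = (w, 0)%N;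
  ap_g : forall j, ((g j).1 + (g j).2 = w)%N;
  ap_res : forall b, ((weight (mu b)).1 %% w = b)%N;
  ap_1 : forall j b, ((g j).1 + (weight (mu b)).1 =
                      q j b * w + (weight (mu (tgt j b))).1)%N;
  ap_2 : forall j b, ((g j).2 + (weight (mu b)).2 =
                      p j b * w + (weight (mu (tgt j b))).2)%N
}.

Variables (mu : 'I_w -> 'X_{1..N}) (tgt : 'I_N -> 'I_w -> 'I_w).
Variables (p q : 'I_N -> 'I_w -> nat).
Hypothesis ap : apery_basis mu tgt p q.

Lemma neq_yz : y != z.
Proof.
apply/eqP => e; have := ap_y ap; rewrite e (ap_z ap) => -[w0 _].
by have := ap_w ap; rewrite w0.
Qed.

Definition yz_mon j b : 'X_{1..N} := (U_(y) *+ p j b + U_(z) *+ q j b)%MM.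

Lemma yz_monE j b l :
  yz_mon j b l = ((y == l) * p j b + (z == l) * q j b)%N.
Proof. by rewrite mnmDE !mulmnE !mnm1E. Qed.

Lemma yz_mon_free (s : seq 'I_N) j b l :
  y \notin s -> z \notin s -> l \in s -> yz_mon j b l = 0%N.
Proof.
move=> ys zs ls; rewrite yz_monE.
have -> : (y == l) = false by apply: contraNF ys => /eqP ->.
by have -> : (z == l) = false by apply: contraNF zs => /eqP ->.
Qed.

Lemma mdeg_yz_mon j b : (mdeg (yz_mon j b) + mdeg (mu (tgt j b)) = mdeg (mu b) + 1)%N.
Proof.
rewrite mdegD !mdegMn !mdeg1 !mul1n; apply/eqP; rewrite -(eqn_pmul2r (ap_w ap)).
have := ap_1 ap j b; have := ap_2 ap j b; have := ap_g ap j.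
have := weight_mdeg (mu b) (ap_g ap); have := weight_mdeg (mu (tgt j b)) (ap_g ap).
by move=> *; apply/eqP; lia.
Qed.

Lemma tgt_val j b : tgt j b = (((g j).1 + b) %% w)%N :> nat.
Proof.
rewrite -(ap_res ap (tgt j b)) -(ap_res ap b) modnDmr (ap_1 ap).
by rewrite modnMDl.
Qed.

Lemma tgtC i j b : tgt i (tgt j b) = tgt j (tgt i b).
Proof. by apply: val_inj; rewrite /= !tgt_val !modnDmr addnCA. Qed.

Lemma yz_monC i j b :
  (yz_mon j b + yz_mon i (tgt j b) = yz_mon i b + yz_mon j (tgt i b))%MM.
Proof.
have wM a c : (a * w = c * w)%N -> a = c.
  by move=> e; apply/eqP; rewrite -(eqn_pmul2r (ap_w ap)) e.
have ep : (p j b + p i (tgt j b) = p i b + p j (tgt i b))%N.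
  apply: wM; have := ap_2 ap j b; have := ap_2 ap i (tgt j b).
  have := ap_2 ap i b; have := ap_2 ap j (tgt i b); rewrite (tgtC i j); lia.
have eq : (q j b + q i (tgt j b) = q i b + q j (tgt i b))%N.
  apply: wM; have := ap_1 ap j b; have := ap_1 ap i (tgt j b).
  have := ap_1 ap i b; have := ap_1 ap j (tgt i b); rewrite (tgtC i j); lia.
apply/mnmP => l; rewrite !mnmDE !mulmnE !mnm1E.
by rewrite addnACA -!mulnDr ep eq !mulnDr addnACA.
Qed.

Section Embedding.
Variables (D : nat) (i1 i2 : 'I_D) (iota : 'I_N -> 'I_D) (s : seq 'I_N).
Hypothesis ne12 : i1 != i2.

Definition pair_mon (a : nat * nat) : 'X_{1..D} :=
  (U_(i1) *+ a.1 + U_(i2) *+ a.2)%MM.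

Lemma pair_mon1 a : pair_mon a i1 = a.1.
Proof.
by rewrite mnmDE !mulmnE !mnm1E eqxx eq_sym (negPf ne12) mul1n mul0n addn0.
Qed.

Lemma pair_mon2 a : pair_mon a i2 = a.2.
Proof. by rewrite mnmDE !mulmnE !mnm1E eqxx (negPf ne12) mul1n mul0n. Qed.

Lemma pair_mon_other a i : i != i1 -> i != i2 -> pair_mon a i = 0%N.
Proof.
move=> n1 n2; rewrite mnmDE !mulmnE !mnm1E.
by rewrite ![_ == i]eq_sym (negPf n1) (negPf n2).
Qed.

Definition eval_set := [:: y, z & s].

(** The evaluation used for the first operators s: the variables y, z and those in
    s go to their monomials in two variables placed at i1 and i2, and every other
    variable goes to a variable of its own. *)
Definition eval_exp l := if l \in eval_set then pair_mon (g l) else U_(iota l)%MM.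

Hypothesis iota_out : forall l, l \notin eval_set -> iota l != i1 /\ iota l != i2.
Hypothesis iota_inj :
  {in [pred l | l \notin eval_set] &, injective iota}.

Local Notation img_exp := (img_exp eval_exp).
Local Notation G := (fun b => pair_mon (weight (mu b))).

Lemma img_exp_yz_mon j b : img_exp (yz_mon j b) = pair_mon (q j b * w, p j b * w)%N.
Proof.
apply/mnmP => i; rewrite img_expE (bigD1 y) //= (bigD1 z) ?[z == y]eq_sym ?neq_yz //=.
rewrite big1 ?addn0 => [|l /andP[ny nz]]; last first.
  by rewrite yz_monE ![_ == l]eq_sym (negPf ny) (negPf nz) muln0.
rewrite !yz_monE !eqxx (negPf neq_yz) eq_sym (negPf neq_yz) !mul1n !mul0n addn0.
rewrite /eval_exp !inE !eqxx orbT /= (ap_y ap) (ap_z ap).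
by rewrite /pair_mon !mnmDE !mulmnE !mnm1E /=; lia.
Qed.

Lemma mon_H_pair j b :
  (img_exp (yz_mon j b) + G (tgt j b) = pair_mon (g j) + G b)%MM.
Proof.
rewrite img_exp_yz_mon; apply/mnmP => i.
have := ap_1 ap j b; have := ap_2 ap j b.
by rewrite /pair_mon !mnmDE !mulmnE !mnm1E /=; case: (_ == i); case: (_ == i); lia.
Qed.

Lemma img_exp_in (m : 'X_{1..N}) i :
  (forall j, j \in s -> m j = 0%N) -> i = i1 \/ i = i2 ->
  img_exp m i = (pair_mon (0, w) i * m y + pair_mon (w, 0) i * m z)%N.
Proof.
move=> frm hi.
rewrite img_expE (bigD1 y) //= (bigD1 z) ?[z == y]eq_sym ?neq_yz //=.
rewrite {1 2}/eval_exp !inE !eqxx orbT /= (ap_y ap) (ap_z ap).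
rewrite big1 ?addn0 // => l /andP[ny nz].
have [ls|ls] := boolP (l \in s); first by rewrite frm // muln0.
have lE : l \notin eval_set by rewrite !inE (negPf ny) (negPf nz).
have [n1 n2] := iota_out lE; rewrite /eval_exp (negPf lE) mnm1E.
by case: hi => ->; rewrite ?(negPf n1) ?(negPf n2).
Qed.

Lemma img_exp_out m l : l \notin eval_set -> img_exp m (iota l) = m l.
Proof.
move=> lE; have [n1 n2] := iota_out lE; rewrite img_expE (bigD1 l) //=.
rewrite {1}/eval_exp (negPf lE) mnm1E eqxx mul1n big1 ?addn0 // => k ne.
rewrite /eval_exp; case: ifPn => kE; first by rewrite pair_mon_other.
rewrite mnm1E; case: eqP => // e; move: ne.
by rewrite (iota_inj _ _ e) ?inE ?eqxx.
Qed.

(** The exponents at i1 and i2 determine the residue b, and then the exponents of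
    z and y. *)
Lemma img_exp_inj b b' (m m' : 'X_{1..N}) :
  (forall j, j \in s -> m j = 0%N) -> (forall j, j \in s -> m' j = 0%N) ->
  (img_exp m + G b = img_exp m' + G b')%MM -> b = b' /\ m = m'.
Proof.
move=> fm fm' e.
have e1 : (w * m z + (weight (mu b)).1 = w * m' z + (weight (mu b')).1)%N.
  have := congr1 (fun M : 'X_{1..D} => M i1) e.
  rewrite (mnmDE _ (img_exp m)) (mnmDE _ (img_exp m')) !img_exp_in //; try by left.
  by rewrite !pair_mon1 /= !mul0n !add0n.
have e2 : (w * m y + (weight (mu b)).2 = w * m' y + (weight (mu b')).2)%N.
  have := congr1 (fun M : 'X_{1..D} => M i2) e.
  rewrite (mnmDE _ (img_exp m)) (mnmDE _ (img_exp m')) !img_exp_in //; try by right.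
  by rewrite !pair_mon2 /= !mul0n !addn0.
have eb : b = b'.
  apply: val_inj => /=; rewrite -(ap_res ap b) -(ap_res ap b').
  by have := congr1 (modn^~ w) e1; rewrite ![(w * _)%N]mulnC !modnMDl.
split=> //; subst b'; have wp := ap_w ap.
have mz : m z = m' z by apply/eqP; rewrite -(eqn_pmul2l wp); apply/eqP; lia.
have my : m y = m' y by apply/eqP; rewrite -(eqn_pmul2l wp); apply/eqP; lia.
apply/mnmP => l; have [|lE] := boolP (l \in eval_set).
  rewrite !inE => /or3P[/eqP ->|/eqP ->|ls] //.
  by rewrite fm // fm'.
have := congr1 (fun M : 'X_{1..D} => M (iota l)) e.
rewrite (mnmDE _ (img_exp m)) (mnmDE _ (img_exp m')) !img_exp_out //.
by move/addIn.
Qed.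

Variable K : fieldType.

Lemma apery_op_span v : y \notin s -> z \notin s ->
  op_span (@mon_op K N w tgt yz_mon) s v <-> vec_eval eval_exp G v = 0.
Proof.
move=> ys zs; apply: op_span_vec_eval.
- move=> j b js; rewrite mon_H_pair /eval_exp.
  by rewrite ifT // !inE js !orbT.
- by move=> j l b _; exact: yz_mon_free.
- exact: img_exp_inj.
Qed.

Lemma apery_op_regular j : y \notin s -> z \notin s -> j \notin eval_set ->
  forall v, op_span (@mon_op K N w tgt yz_mon) s (v *m mon_op K tgt yz_mon j) ->
            op_span (@mon_op K N w tgt yz_mon) s v.
Proof.
move=> ys zs jE; apply: (@mon_op_regular _ _ _ _ _ _ eval_exp G s _ _ _ j (pair_mon (g j))).
- move=> i b js; rewrite mon_H_pair /eval_exp.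
  by rewrite ifT // !inE js !orbT.
- by move=> i l b _; exact: yz_mon_free.
- exact: img_exp_inj.
- exact: mon_H_pair.
- apply/eqP => /(congr1 (fun M : 'X_{1..D} => M (iota j))).
  have [n1 n2] := iota_out jE.
  by rewrite pair_mon_other // /eval_exp (negPf jE) mnm1E eqxx.
Qed.

End Embedding.

Definition inner_vars := [seq j <- enum 'I_N | (j != y) && (j != z)].

(** Here the two variables i1 and i2 of the target are the slots of z and y, which
    are free because z and y are always evaluated. *)
Lemma apery_koszul_regular (K : fieldType) s : uniq s -> y \notin s -> z \notin s ->
  op_regular (@mon_op K N w tgt yz_mon) s.
Proof.
elim: s => //= t s IH /andP[ts us]; rewrite !inE !negb_or => /andP[yt ys] /andP[zt zs].
split; last exact: IH.
apply: (@apery_op_regular N z y id s) => //.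
- by rewrite eq_sym neq_yz.
- by move=> l; rewrite !inE !negb_or => /and3P[-> ->].
- by rewrite /eval_set !inE !negb_or ![t == _]eq_sym yt zt ts.
Qed.

End Apery.
(** * The Koszul resolution of the semigroup ring *)
Section SbarProj.
Variables (K : fieldType) (e m n : nat).
Local Notation N := (size (Sbar_gens e m n)).
Local Notation Q := {mpoly K[N]}.
Local Notation A := (Sbar_ring K e m n).
Local Notation images := (Sbar_images K e m n).
Implicit Types p q : Q.

Lemma Sbar_proj_eq p q :
  Sbar_proj p = Sbar_proj q <-> p \mPo images = q \mPo images.
Proof.
rewrite /Sbar_proj; have := Quotient.idealrBE 
  ((@Sbar_ideal K e m n : pred Q) : idealr Q) p q.
rewrite unfold_in /Sbar_ideal rmorphB /= subr_eq0 => h.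
by split=> [/eqP|/eqP]; [rewrite -h => /eqP | rewrite h => /eqP].
Qed.

Lemma Sbar_projD p q : Sbar_proj (p + q) = Sbar_proj p + Sbar_proj q.
Proof. exact: rmorphD. Qed.

Lemma Sbar_projM p q : Sbar_proj (p * q) = Sbar_proj p * Sbar_proj q.
Proof. exact: rmorphM. Qed.

Lemma Sbar_proj0 : Sbar_proj 0 = 0 :> A.
Proof. exact: rmorph0. Qed.

Lemma Sbar_proj1 : Sbar_proj 1 = 1 :> A.
Proof. exact: rmorph1. Qed.

Lemma Sbar_proj_sum (I : Type) (r : seq I) (F : I -> Q) :
  Sbar_proj (\sum_(i <- r) F i) = \sum_(i <- r) Sbar_proj (F i).
Proof. exact: rmorph_sum. Qed.

Lemma Sbar_scale_proj p q : p *: (Sbar_proj q : A) = Sbar_proj (p * q).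
Proof. by rewrite Sbar_projM. Qed.

Lemma Sbar_proj_surj (a : A) : exists p, a = Sbar_proj p.
Proof. by exists (repr a); rewrite /Sbar_proj reprK. Qed.

Definition gen_exp (l : 'I_N) : nat * nat := tnth (in_tuple (Sbar_gens e m n)) l.

Local Notation img a := (pair_mon ord0 (ord_max : 'I_2) a).

Lemma Sbar_imagesE : images = [tuple 'X_[img (gen_exp l)] | l < N].
Proof.
apply: eq_from_tnth => l; rewrite tnth_mktuple tnth_map /gen_exp.
by rewrite /pair_mon mpolyXD !mpolyXn.
Qed.

Lemma mPo_mon_eval p : p \mPo images = mon_eval (fun l => img (gen_exp l)) p.
Proof. by rewrite Sbar_imagesE. Qed.

Lemma mdeg_img a : mdeg (img a) = (a.1 + a.2)%N.
Proof. by rewrite mdegD !mdegMn !mdeg1 !mul1n. Qed.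

Lemma img_exp_img mu : img_exp (fun l => img (gen_exp l)) mu = img (weight gen_exp mu).
Proof.
apply/mnmP => i; rewrite img_expE mnmDE !mulmnE !mnm1E.
rewrite /weight /= !big_distrr -big_split /=; apply: eq_bigr => l _.
by rewrite mnmDE !mulmnE !mnm1E mulnDl !mulnA.
Qed.

Lemma mem_Sbar_gens a : a \in Sbar_gens e m n -> (0 < e)%N ->
  (a.1 + a.2 = 2 * e - 1)%N.
Proof.
rewrite mem_rcons inE => /orP[/eqP -> //|/mapP[i]].
by rewrite mem_filter mem_iota => /andP[_ hi] -> /=; lia.
Qed.

Lemma gen_exp_mdeg l : (0 < e)%N -> ((gen_exp l).1 + (gen_exp l).2 = 2 * e - 1)%N.
Proof. by apply: mem_Sbar_gens; exact: mem_tnth. Qed.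

Lemma mon_eval_homog_part d p : (0 < e)%N ->
  mon_eval (fun l => img (gen_exp l)) (homog_part d p) =
  homog_part (d * (2 * e - 1)%N%:Z) (mon_eval (fun l => img (gen_exp l)) p).
Proof.
move=> e0; rewrite [p]mpolyE mon_eval_sum (big_morph _ (homog_partD d) (homog_part0 _ _ d)).
rewrite mon_eval_sum (big_morph _ (homog_partD _) (homog_part0 _ _ _)); apply: eq_bigr => k _.
rewrite mon_evalZ !homog_partZ mon_evalZ !homog_partX mon_evalX homog_partX; congr (_ *: _).
have -> : mdeg (img_exp (fun l => img (gen_exp l)) k) = (mdeg k * (2 * e - 1))%N.
  rewrite /img_exp mdeg_sum mdegE big_distrl /=; apply: eq_bigr => l _.
  by rewrite mdegMn mdeg_img gen_exp_mdeg // mulnC.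
have w0 : (2 * e - 1)%N%:Z != 0 by lia.
rewrite PoszM (inj_eq (mulIf w0)); case: eqP => _; first exact: mon_evalX.
exact: comp_mpoly0.
Qed.

(** The defining ideal is homogeneous because evaluation multiplies degrees by
    2e-1. *)
Lemma Sbar_graded_relations : (0 < e)%N -> graded_relations (@Sbar_piece K e m n).
Proof.
move=> e0 k v dg x d a hx [Y hY ->] eqY.
have /fin_all_exists[P hP] : forall l, exists P : Q,
    homogz (dg l) P /\ x l = Sbar_proj P.
  by move=> l; have [P ? ?] := hx l; exists P.
have xE l : x l = Sbar_proj (P l) by case: (hP l).
have sumE (f : 'I_k -> Q) : \sum_l f l *: x l = Sbar_proj (\sum_l f l * P l).
  by rewrite Sbar_proj_sum; apply: eq_bigr => l _; rewrite xE Sbar_scale_proj.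
move: eqY; rewrite !sumE => /Sbar_proj_eq; rewrite !mPo_mon_eval => eqY.
apply/Sbar_proj_eq; rewrite !mPo_mon_eval -(homog_part_id hY).
rewrite mon_eval_homog_part // -eqY -mon_eval_homog_part //.
congr mon_eval; rewrite homog_part_sum; apply: eq_bigr => l _.
by case: (hP l) => hl _; rewrite (homog_partM _ _ hl).
Qed.

Lemma Sbar_pieceZ d d' p (a : A) : homogz d p -> Sbar_piece d' a ->
  Sbar_piece (d + d') (p *: a).
Proof.
move=> hp [P hP ->]; exists (p * P); first exact: homogzM.
by rewrite Sbar_scale_proj.
Qed.

Lemma Sbar_piece_sum d (I : finType) (F : I -> A) :
  (forall i, Sbar_piece d (F i)) -> Sbar_piece d (\sum_i F i).
Proof.
move=> h; elim/big_ind: _ => //; first by exists 0; rewrite ?homogz0 ?Sbar_proj0.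
move=> x y [P hP ->] [R hR ->]; exists (P + R); first exact: homogzD.
by rewrite Sbar_projD.
Qed.

Section Resolution.
Local Notation w := (2 * e - 1)%N.
Variables (y z : 'I_N) (mu : 'I_w -> 'X_{1..N}) (tgt : 'I_N -> 'I_w -> 'I_w).
Variables (p q : 'I_N -> 'I_w -> nat) (b0 : 'I_w).
Hypothesis ap : apery_basis gen_exp y z mu tgt p q.
Hypothesis mu0 : mu b0 = 0%MM.

Local Notation op := (@mon_op K N w tgt (yz_mon y z p q)).
Local Notation vars := (inner_vars y z).
Local Notation C := (koszul (fun b => (mdeg (mu b))%:Z) op vars).

Let e_gt0 : (0 < e)%N.
Proof. by have := ap_w ap; lia. Qed.

Let y_vars : y \notin vars.
Proof. by rewrite mem_filter eqxx. Qed.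

Let z_vars : z \notin vars.
Proof. by rewrite mem_filter eqxx andbF. Qed.

Lemma Sbar_koszul_resolves :
  resolves (fun b => (mdeg (mu b))%:Z) op (op_span op vars) C.
Proof.
apply: koszul_resolves.
- exact: mon_op_homog (mdeg_yz_mon ap).
- move=> i j; apply: mon_opC => b; first exact: (tgtC ap).
  exact: (yz_monC ap).
- by apply: (apery_koszul_regular ap) => //; rewrite filter_uniq ?enum_uniq.
Qed.

Definition apery_elt b : A := Sbar_proj 'X_[mu b].

(** When all variables other than y and z are operators, the embedding of the
    quotient of Q^w is evaluation in the two-variable polynomial ring itself, so
    this says that the cokernel of the Koszul complex is the semigroup ring. *)
Lemma apery_comb_eq0 (v : 'rV[Q]_w) :
  \sum_b v 0 b *: apery_elt b = 0 <-> op_span op vars v.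
Proof.
have in_vars l : l \in eval_set y z vars.
  by rewrite /eval_set !inE mem_filter mem_enum andbT; case: eqP; case: eqP.
rewrite (apery_op_span ap (i1 := ord0) (i2 := ord_max : 'I_2)
  (iota := fun=> ord0)) //; first last.
- by move=> l l'; rewrite inE in_vars.
- by move=> l; rewrite in_vars.
under eq_bigr do rewrite Sbar_scale_proj.
rewrite -Sbar_proj_sum -Sbar_proj0 Sbar_proj_eq !mPo_mon_eval {2}/mon_eval comp_mpoly0.
suff -> : mon_eval (fun l => img (gen_exp l)) (\sum_b v 0 b * 'X_[mu b]) =
  vec_eval (eval_exp gen_exp y z ord0 ord_max (fun=> ord0) vars)
      (fun b => img (weight gen_exp (mu b))) v by [].
rewrite mon_eval_sum; apply: eq_bigr => b _; rewrite mon_evalM mon_evalX; congr (_ * _).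
  rewrite /mon_eval; congr (_ \mPo _); apply: eq_from_tnth => l.
  by rewrite !tnth_mktuple /eval_exp in_vars.
by rewrite img_exp_img.
Qed.

Definition kos_aug (k : 'I_(oc_rank C 0)) : A :=
  \sum_b oc_aug C k b *: apery_elt b.

Lemma kos_augE (v : 'rV[Q]_(oc_rank C 0)) :
  \sum_k v 0 k *: kos_aug k = \sum_b (v *m oc_aug C) 0 b *: apery_elt b.
Proof.
rewrite /kos_aug; under eq_bigr do rewrite scaler_sumr.
rewrite exchange_big /=; apply: eq_bigr => b _.
by rewrite mxE scaler_suml; apply: eq_bigr => k _; rewrite scalerA.
Qed.

Lemma kos_aug_homog k : Sbar_piece (oc_deg k) (kos_aug k).
Proof.
apply: Sbar_piece_sum => b.
have -> : oc_deg k = oc_deg k - (mdeg (mu b))%:Z + (mdeg (mu b))%:Z by rewrite subrK.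
apply: Sbar_pieceZ; first exact: (oc_aug_homog Sbar_koszul_resolves).
by exists 'X_[mu b]; rewrite //= dhomogX.
Qed.

Lemma kos_aug_surj (x : A) : exists v : 'rV[Q]_(oc_rank C 0),
  x = \sum_k v 0 k *: kos_aug k.
Proof.
have [P ->] := Sbar_proj_surj x; have [B hB] := oc_aug_surj Sbar_koszul_resolves.
exists (P *: delta_mx 0 b0 *m B); rewrite kos_augE -mulmxA hB mulmx1.
rewrite (bigD1 b0) //= big1 ?addr0 => [|b ne]; last first.
  by rewrite !mxE (negPf ne) mulr0 scale0r.
by rewrite !mxE !eqxx mulr1 Sbar_scale_proj mu0 mpolyX0 mulr1.
Qed.

Lemma kos_exact0 (v : 'rV[Q]_(oc_rank C 0)) :
  \sum_k v 0 k *: kos_aug k = 0 <-> exists u, v = u *m oc_diff C 0.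
Proof.
by rewrite kos_augE apery_comb_eq0; exact: (oc_exact0 Sbar_koszul_resolves).
Qed.

Definition Sbar_resolution : graded_free_resolution (@Sbar_piece K e m n) := {|
  fr_rank := oc_rank C;
  fr_deg := @oc_deg _ _ _ _ C;
  fr_diff := oc_diff C;
  fr_aug := kos_aug;
  fr_diff_homog := oc_diff_homog Sbar_koszul_resolves;
  fr_aug_homog := kos_aug_homog;
  fr_aug_surj := kos_aug_surj;
  fr_exact0 := kos_exact0;
  fr_exact := oc_exact Sbar_koszul_resolves
|}.

Theorem Sbar_regularity (r : nat) :
  (forall b, (mdeg (mu b) <= r)%N) -> (exists b, mdeg (mu b) = r) ->
  has_regularity (@Sbar_piece K e m n) r.
Proof.
move=> le_r [b hb].
have [k hk] := @koszul_deg_top K N w _ (fun b => (mdeg (mu b))%:Z) op b vars.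
apply: (@regularity_of_resolution _ _ _ _ Sbar_resolution r (size vars) k).
- exact: Sbar_graded_relations.
- by move=> i k'; apply: koszul_deg_le => b'; rewrite lez_nat.
- by rewrite [fr_deg _]hk hb.
- exact: koszul_rank_gt.
Qed.

End Resolution.
End SbarProj.
(** * Consequences of Cohen-Macaulayness *)
Lemma mnm_neq0 n (m : 'X_{1..n}) : m != 0%MM -> exists i, m i != 0%N.
Proof.
move=> nz; apply/existsP; rewrite -negb_forall; apply: contra nz => /forallP h.
by apply/eqP/mnmP => i; rewrite mnm0E; apply/eqP; exact: h.
Qed.

Lemma mcoeff0_comp (R : comNzRingType) n k (lp : n.-tuple {mpoly R[k]}) p :
  (forall i, (tnth lp i)@_0%MM = 0) -> (p \mPo lp)@_0%MM = p@_0%MM.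
Proof.
move=> lp0; rewrite comp_mpolyE [in RHS](mpolyE p) !raddf_sum; apply: eq_bigr => m _.
rewrite /= !mcoeffZ rmorph_prod mcoeffX; congr (_ * _).
have [->|nz] := eqVneq m 0%MM.
  by rewrite big1 // => i _; rewrite mnm0E expr0 rmorph1.
have [i mi] := mnm_neq0 nz.
by rewrite (bigD1 i) //= rmorphXn /= lp0 expr0n (negPf mi) mul0r.
Qed.

Section CohenMacaulayClosure.
Variables (K : fieldType) (e m n : nat).
Local Notation N := (size (Sbar_gens e m n)).
Local Notation Q := {mpoly K[N]}.
Local Notation A := (Sbar_ring K e m n).
Local Notation images := (Sbar_images K e m n).
Local Notation g := (@gen_exp e m n).
Local Notation img a := (pair_mon ord0 (ord_max : 'I_2) a).

Definition Sbar_mem (s : nat * nat) := exists mu, weight g mu = s.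

Definition Sbar_emb (a : A) : {mpoly K[2]} := (repr a : Q) \mPo images.

Lemma Sbar_emb_proj (p : Q) : Sbar_emb (Sbar_proj p) = p \mPo images.
Proof. by apply/Sbar_proj_eq; rewrite /Sbar_proj reprK. Qed.

Lemma Sbar_emb_inj : injective Sbar_emb.
Proof.
move=> a b; have [p ->] := Sbar_proj_surj a; have [q ->] := Sbar_proj_surj b.
by rewrite !Sbar_emb_proj => /Sbar_proj_eq.
Qed.

Lemma Sbar_embD a b : Sbar_emb (a + b) = Sbar_emb a + Sbar_emb b.
Proof.
have [p ->] := Sbar_proj_surj a; have [q ->] := Sbar_proj_surj b.
by rewrite -Sbar_projD !Sbar_emb_proj rmorphD.
Qed.

Lemma Sbar_embM a b : Sbar_emb (a * b) = Sbar_emb a * Sbar_emb b.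
Proof.
have [p ->] := Sbar_proj_surj a; have [q ->] := Sbar_proj_surj b.
by rewrite -Sbar_projM !Sbar_emb_proj rmorphM.
Qed.

Lemma Sbar_emb0 : Sbar_emb 0 = 0.
Proof. by rewrite -Sbar_proj0 Sbar_emb_proj rmorph0. Qed.

Lemma Sbar_emb1 : Sbar_emb 1 = 1.
Proof. by rewrite -Sbar_proj1 Sbar_emb_proj rmorph1. Qed.

Lemma img_inj a b : img a = img b -> a = b.
Proof.
move=> h; have ne : (ord0 : 'I_2) != ord_max by [].
have := congr1 (fun M : 'X_{1..2} => M ord0) h.
have := congr1 (fun M : 'X_{1..2} => M ord_max) h.
rewrite !pair_mon1 // !pair_mon2 //.
by case: a b {h} => [a1 a2] [b1 b2] /= -> ->.
Qed.

Lemma Sbar_emb_mem a s : Sbar_emb a = 'X_[img s] -> Sbar_mem s.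
Proof.
have [p ->] := Sbar_proj_surj a; rewrite Sbar_emb_proj mPo_mon_eval => h.
have : (mon_eval (fun l => img (g l)) p)@_(img s) != 0.
  by rewrite h mcoeffX eqxx oner_neq0.
rewrite {1}[p]mpolyE mon_eval_sum raddf_sum => nz.
have [/hasP[mu _ /eqP e1]|/hasPn none] :=
    boolP (has (fun mu => weight g mu == s) (msupp p)); first by exists mu.
case/eqP: nz; rewrite big_seq big1 // => mu /none ne /=.
rewrite mon_evalZ mon_evalX img_exp_img mcoeffZ mcoeffX.
by case: eqP => [/img_inj e1|]; [rewrite e1 eqxx in ne | rewrite mulr0].
Qed.

Hypothesis e_gt0 : (0 < e)%N.

Lemma mcoeff0_images (p : Q) : (p \mPo images)@_0%MM = p@_0%MM.
Proof.
apply: mcoeff0_comp => l; rewrite Sbar_imagesE tnth_mktuple mcoeffX.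
rewrite -mdeg_eq0 mdeg_img gen_exp_mdeg //.
by case: eqP => //; lia.
Qed.

(** If adding any generator to s gives an element of the semigroup, then so does
    adding any nonzero element of the semigroup. *)
Lemma Sbar_emb_mul_mon s (a : A) :
  (forall l, Sbar_mem ((g l).1 + s.1, (g l).2 + s.2)%N) ->
  (Sbar_emb a)@_0%MM = 0 -> exists b, Sbar_emb b = Sbar_emb a * 'X_[img s].
Proof.
move=> hs; have [p ->] := Sbar_proj_surj a; rewrite Sbar_emb_proj mcoeff0_images.
suff : p@_0%MM = 0 -> exists q : Q, q \mPo images = (p \mPo images) * 'X_[img s].
  by move=> h /h[q hq]; exists (Sbar_proj q); rewrite Sbar_emb_proj.
elim/mpolyind: p => [_|c mu p nmu nz IH]; first by exists 0; rewrite rmorph0 mul0r.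
rewrite mcoeffD mcoeffZ mcoeffX.
have [mu0|munz] := eqVneq mu 0%MM.
  rewrite mulr1 -mu0 (memN_msupp_eq0 nmu) addr0 => c0.
  by rewrite c0 eqxx in nz.
rewrite mulr0 add0r => /IH[q hq].
have [i mi] := mnm_neq0 munz.
have [nu hnu] := hs i.
exists (c *: 'X_[(mu - U_(i)) + nu] + q).
rewrite !comp_mpolyD mulrDl -hq; congr (_ + _).
rewrite /= !comp_mpolyZ -scalerAl !mPo_mon_eval !mon_evalX -mpolyXD; congr (_ *: mpolyX _ _).
rewrite -[in RHS](@submK _ U_(i)%MM mu) ?lep1mP //.
apply/mnmP => k; move: hnu => -[h1 h2].
rewrite !img_exp_img !mnmDE !mulmnE !mnm1E /=.
have -> : (\sum_l (g l).1 * ((mu - U_(i)) + nu)%MM l =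
    \sum_l (g l).1 * (mu - U_(i))%MM l + ((g i).1 + s.1))%N.
  by rewrite -h1 -big_split; apply: eq_bigr => l _; rewrite mnmDE mulnDr.
have -> : (\sum_l (g l).2 * ((mu - U_(i)) + nu)%MM l =
    \sum_l (g l).2 * (mu - U_(i))%MM l + ((g i).2 + s.2))%N.
  by rewrite -h2 -big_split; apply: eq_bigr => l _; rewrite mnmDE mulnDr.
have sumU (f : 'I_N -> nat) : (\sum_l f l * ((mu - U_(i)) + U_(i))%MM l =
    \sum_l f l * (mu - U_(i))%MM l + f i)%N.
  under eq_bigr do rewrite mnmDE mulnDr.
  rewrite big_split /=; congr (_ + _)%N; rewrite (bigD1 i) //= mnm1E eqxx muln1.
  by rewrite big1 ?addn0 // => l ne; rewrite mnm1E eq_sym (negPf ne) muln0.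
rewrite !sumU; lia.
Qed.

Lemma prime_kernel (R : idomainType) (f : {rmorphism {mpoly K[2]} -> R}) :
  is_prime_ideal (fun a : A => f (Sbar_emb a) = 0).
Proof.
split; first split.
- by rewrite Sbar_emb0 rmorph0.
- by move=> a b ha hb; rewrite Sbar_embD rmorphD ha hb addr0.
- by move=> a b hb; rewrite Sbar_embM rmorphM hb mulr0.
- by rewrite Sbar_emb1 rmorph1 => /eqP; rewrite oner_eq0.
- move=> a b /eqP; rewrite Sbar_embM rmorphM mulf_eq0.
  by case/orP => /eqP; [left | right].
Qed.

Definition irrelevant (a : A) : Prop := (Sbar_emb a)@_0%MM = 0.

Lemma irrelevant_maximal : is_maximal_ideal irrelevant.
Proof.
have [[irr0 irrD irrM] irr1 _] := prime_kernel (mcoeff (0%MM : 'X_{1..2})).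
split=> // J [J0 JD JM] sub J1 x Jx.
apply/eqP/negPn/negP => nz; apply: J1.
set c := (Sbar_emb x)@_0%MM in nz.
pose k (a : K) : A := Sbar_proj (a%:MP).
have kE a : Sbar_emb (k a) = a%:MP by rewrite Sbar_emb_proj comp_mpolyC.
have -> : 1 = k c^-1 * (x + - 1 * (x - k c)).
  apply: Sbar_emb_inj; rewrite mulN1r opprB addrC subrK Sbar_embM !kE Sbar_emb1.
  by rewrite -mpolyCM mulVf // mpolyC1.
apply/JM/JD => //; apply/JM/sub.
have -> : - k c = k (- c) by rewrite /k mpolyCN; apply: esym; exact: rmorphN.
by rewrite /irrelevant Sbar_embD mcoeffD kE mcoeffC eqxx mulr1 subrr.
Qed.

(** The chain 0, (t1), (t1, t2), contracted from the two-variable polynomial ring. *)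
Lemma irrelevant_chain :
  (exists y, g y = (0, 2 * e - 1)%N) -> (exists z, g z = (2 * e - 1, 0)%N) ->
  exists C, prime_chain irrelevant 2 C.
Proof.
move=> [y hy] [z hz].
have w0 : (2 * e - 1 == 0)%N = false by lia.
pose t1_0 : {rmorphism {mpoly K[2]} -> {mpoly K[2]}} :=
  comp_mpoly [tuple (0 : {mpoly K[2]}); 'X_ord_max].
have t1_0_mcoeff0 f : (t1_0 f)@_0%MM = f@_0%MM.
  apply: mcoeff0_comp => i; case: (unliftP ord0 i) => [j ->|->].
    by rewrite (ord1 j) /= mcoeffX mnm1_eq0.
  by rewrite mcoeff0.
have emb_var l : Sbar_emb (Sbar_proj 'X_l) = 'X_ord0 ^+ (g l).1 * 'X_ord_max ^+ (g l).2.
  by rewrite Sbar_emb_proj mPo_mon_eval mon_evalXU /pair_mon mpolyXD !mpolyXn.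
exists (fun i (a : A) => match i with
  | 0 => Sbar_emb a = 0 | 1 => t1_0 (Sbar_emb a) = 0 | _ => irrelevant a end).
split=> //.
- by case=> [|[|i]] _; [exact: (prime_kernel idfun) | exact: prime_kernel
                       | exact: (prime_kernel (mcoeff (0%MM : 'X_{1..2})))].
- case=> [|[|i]] // _; split.
  + by move=> a ->; rewrite rmorph0.
  + exists (Sbar_proj 'X_z).
      rewrite emb_var hz rmorphM rmorphXn /= comp_mpolyXU /=.
      by rewrite expr0n w0 mul0r.
    apply/eqP; rewrite emb_var hz expr0 mulr1 mpolyXn -msupp_eq0.
    by rewrite msuppX.
  + by move=> a h; rewrite /irrelevant -t1_0_mcoeff0 h mcoeff0.
  + exists (Sbar_proj 'X_y).
      rewrite /irrelevant emb_var hy expr0 mul1r mpolyXn mcoeffX.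
      rewrite -mdeg_eq0 mdegMn mdeg1 mul1n.
      by rewrite w0.
    apply/eqP; rewrite emb_var hy expr0 mul1r rmorphXn /= comp_mpolyXU /=.
    by rewrite mpolyXn -msupp_eq0 msuppX.
Qed.

(** A monomial t^s as in the hypothesis multiplies the irrelevant ideal into the
    ring.  For a regular sequence a, b in that ideal, b (a t^s) = a (b t^s) shows
    that a t^s is a multiple of a, and a can be cancelled in the polynomial
    ring. *)
Lemma Sbar_closed_of_CM s : Cohen_Macaulay A ->
  (exists y, g y = (0, 2 * e - 1)%N) -> (exists z, g z = (2 * e - 1, 0)%N) ->
  (forall l, Sbar_mem ((g l).1 + s.1, (g l).2 + s.2)%N) -> Sbar_mem s.
Proof.
move=> [_ CM] hy hz hs.
have [d [[rs [[rs1 reg] rsP szrs]] _] [_ height]] := CM _ irrelevant_maximal.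
have [C chain] := irrelevant_chain hy hz; have := height _ _ chain.
rewrite -szrs; case: rs rs1 reg rsP {szrs} => [|a [|b rs]] //= rs1 reg rsP _.
have Pa := rsP a (mem_head _ _).
have Pb : irrelevant b by apply: rsP; rewrite !inE eqxx orbT.
have [a' ha'] := Sbar_emb_mul_mon hs Pa.
have [b' hb'] := Sbar_emb_mul_mon hs Pb.
have anz : Sbar_emb a != 0.
  apply/eqP => a0; have {a0} a0 : a = 0 by apply: Sbar_emb_inj; rewrite a0 Sbar_emb0.
  have [c /esym/eqP] : ideal_span (take 0 [:: a, b & rs]) (1 : A).
    apply: reg => //; exists (fun=> 0); rewrite big_ord0 /= a0 mul0r //.
  by rewrite big_ord0 eq_sym oner_eq0.
have [c hc] : ideal_span (take 1 [:: a, b & rs]) a'.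
  apply: reg => //; exists (fun=> b'); rewrite /= big_ord1 /=.
  by apply: Sbar_emb_inj; rewrite !Sbar_embM ha' hb' mulrA mulrAC.
apply: (@Sbar_emb_mem (c ord0)); apply: (mulfI anz).
by rewrite -ha' hc /= big_ord1 Sbar_embM mulrC.
Qed.

End CohenMacaulayClosure.
(** * Closed semigroups have monomial bases over K[y, z] *)
Section AperyExists.
Variables (N w : nat) (g : 'I_N -> nat * nat) (y z : 'I_N).
Hypothesis w_gt0 : (0 < w)%N.
Hypothesis gw : forall j, ((g j).1 + (g j).2 = w)%N.
Hypothesis gy : g y = (0, w)%N.
Hypothesis gz : g z = (w, 0)%N.

Definition reach (d a : nat) : bool :=
  [exists mu : 'X_{1..N < d.+1}, (mdeg mu == d) && ((weight g mu).1 == a)].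

Lemma reachP d a :
  reflect (exists2 mu, mdeg mu = d & (weight g mu).1 = a) (reach d a).
Proof.
apply: (iffP existsP) => [[mu /andP[/eqP hd /eqP ha]]|[mu hd ha]].
  by exists mu.
have lt : (mdeg mu < d.+1)%N by rewrite hd.
by exists (BMultinom lt); apply/andP; split; apply/eqP.
Qed.

Lemma reach_le d a : reach d a -> (a <= d * w)%N.
Proof. by case/reachP => mu <- <-; rewrite -(weight_mdeg mu gw) leq_addr. Qed.

Lemma reach0 : reach 0 0.
Proof.
apply/reachP; exists 0%MM; first by rewrite mdeg0.
by rewrite /= big1 // => l _; rewrite mnm0E muln0.
Qed.

Lemma reachD d a d' a' : reach d a -> reach d' a' -> reach (d + d') (a + a').
Proof.
move=> /reachP[mu <- <-] /reachP[nu <- <-]; apply/reachP.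
exists (mu + nu)%MM; first by rewrite mdegD.
by rewrite /= -big_split; apply: eq_bigr => l _; rewrite mnmDE mulnDr.
Qed.

Lemma reach1 l : reach 1 (g l).1.
Proof.
apply/reachP; exists U_(l)%MM; first by rewrite mdeg1.
rewrite /= (bigD1 l) //= mnm1E eqxx muln1 big1 ?addn0 // => k ne.
by rewrite mnm1E eq_sym (negPf ne) muln0.
Qed.

Lemma reach_yz d a q k : reach d a -> (q <= k)%N -> reach (d + k) (a + q * w).
Proof.
move=> rd; elim: k q => [|k IH] q.
  by case: q => // _; rewrite mul0n !addn0.
case: q => [_|q lt].
  by have := reachD (IH 0%N isT) (reach1 y); rewrite gy addn1 addn0 addnS.
have := reachD (IH q lt) (reach1 z); rewrite gz addn1 addnS.
by rewrite -addnA -mulSnr.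
Qed.

Lemma reach_mono d d' a : reach d a -> (d <= d')%N -> reach d' a.
Proof.
move=> rd le; have := reach_yz rd (leq0n (d' - d)).
by rewrite subnKC // mul0n addn0.
Qed.

Hypothesis closed : forall d a,
  (forall l, reach d.+1 ((g l).1 + a)) -> reach d a.

Section Walk.
Variables (d a : nat).

(** By closedness, some generator moves a gap to a point outside the semigroup,
    which is again a gap; the walk follows such generators. *)
Definition walk_step i b :=
  if [pick l | ~~ reach (d + i).+1 ((g l).1 + b)] is Some l
  then ((g l).1 + b)%N else b.

Fixpoint walk i := if i is i'.+1 then walk_step i' (walk i') else a.

(** A gap is a point outside the semigroup, both of whose translates by (0, w) and
    by (w, 0) are inside. *)
Definition gap i := [&& reach (d + i).+1 (walk i),
  reach (d + i).+1 (walk i + w) & ~~ reach (d + i) (walk i)].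

Lemma walk_bounds i k :
  (walk i <= walk (i + k))%N /\ (walk (i + k) <= walk i + k * w)%N.
Proof.
elim: k => [|k [IH1 IH2]]; first by rewrite !addn0.
rewrite addnS /= /walk_step mulSn; case: pickP => [l _|_]; last by lia.
by have := gw l; lia.
Qed.

Lemma gap_walk i : gap 0 -> gap i.
Proof.
move=> g0; elim: i => // i /and3P[r1 r2 nr]; rewrite /gap /= /walk_step.
case: pickP => [l hl|none]; last first.
  by case/negP: nr; apply: closed => l; have := none l => /negbFE.
rewrite addnS hl andbT -{1 2}(add1n (d + i).+1).
by rewrite (reachD (reach1 l) r1) -addnA (reachD (reach1 l) r2).
Qed.

(** Among w+1 points of the walk two have first coordinates congruent modulo w.
    The later one is obtained from the earlier one by adding copies of (0, w) and
    (w, 0), at least one in total, so it is in the semigroup. *)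
Lemma no_gap : ~~ gap 0.
Proof.
apply/negP => g0.
have : ~~ injectiveb (fun i : 'I_w.+1 => Ordinal (ltn_pmod (walk i) w_gt0)).
  apply/negP => /injectiveP /leq_card.
  by rewrite !card_ord ltnn.
case/injectivePn => i [j ij /(congr1 val) /= eqm].
wlog lt : i j ij eqm / (i < j)%N.
  move=> th; move: (ij); rewrite neq_ltn => /orP[lt|lt]; first exact: (th i j).
  by apply: (th j i) => //; rewrite eq_sym.
have [k kE] : exists k, j = (i + k.+1)%N :> nat.
  by exists (j - i).-1; rewrite prednK ?subn_gt0 // subnKC // ltnW.
have [lo hi] := walk_bounds i k.+1; rewrite -kE in lo hi.
have [q qE] : exists q, walk j = (walk i + q * w)%N.
  exists ((walk j - walk i) %/ w)%N.
  by rewrite divnK ?subnKC // -eqn_mod_dvd // eqm.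
have /and3P[r1 r2 _] := gap_walk i g0.
have /and3P[_ _ /negP] := gap_walk j g0; apply; rewrite kE -kE qE.
have qk : (q <= k.+1)%N by rewrite -(leq_pmul2r w_gt0); lia.
case: q qE qk => [|q] qE qk.
  by rewrite mul0n addn0; apply: reach_mono r1 _; rewrite kE; lia.
rewrite mulSn addnA; have -> : (d + j = (d + i).+1 + k)%N by rewrite kE; lia.
exact: reach_yz.
Qed.

End Walk.

Lemma reach_corner d a : reach d.+1 a -> reach d.+1 (a + w) -> reach d a.
Proof.
move=> r1 r2; have := no_gap d a; rewrite /gap /= !addn0.
by rewrite r1 r2 negbK.
Qed.

(** Repeated use of [reach_corner]: if a + q w occurs in a degree smaller than
    d + q, then d > 0 and a occurs in degree d - 1. *)
Lemma reach_descent d a q d' : reach d a -> reach d' (a + q * w) ->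
  (d' < d + q)%N -> (0 < d)%N && reach d.-1 a.
Proof.
elim: q d' => [|q IH] d' r1 r2 lt.
  rewrite mul0n addn0 in r2; rewrite addn0 in lt.
  by rewrite (leq_ltn_trans _ lt) //=; apply: reach_mono r2 _; lia.
case: d IH r1 lt => [|d] IH r1 lt.
  have := reach_le r1; have := reach_le r2; rewrite mul0n.
  move: lt; rewrite add0n => lt le.
  by have := leq_mul (lt : (d' <= q)%N) (leqnn w); rewrite mulSn in le; lia.
apply: (IH (d + q)%N) => //.
apply: reach_corner.
  by rewrite -addSn; exact: reach_yz.
rewrite -addnA -mulSnr; apply: reach_mono r2 _; lia.
Qed.

Variable r : nat.
Hypothesis cover : forall b : 'I_w, exists2 a, reach r a & (a %% w = b)%N.
Hypothesis attained : exists b : 'I_w, forall a, reach r.-1 a -> (a %% w)%N != b.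
Hypothesis r_gt0 : (0 < r)%N.

(** The monomials mu b are chosen of least degree in their residue class.  Any
    other element of the class then is mu b plus copies of (0, w) and (w, 0), for
    otherwise [reach_descent] would lower one of the two degrees. *)
Theorem apery_basis_exists : exists mu tgt p q (b0 : 'I_w),
  [/\ apery_basis g y z mu tgt p q, mu b0 = 0%MM,
      forall b, (mdeg (mu b) <= r)%N & exists b, mdeg (mu b) = r].
Proof.
have /fin_all_exists[mu hmu] : forall b : 'I_w, exists mu : 'X_{1..N},
    ((weight g mu).1 %% w = b)%N /\
    forall d a, reach d a -> (a %% w = b)%N -> (mdeg mu <= d)%N.
  move=> b; pose P d := [exists a : 'I_(d * w).+1, reach d a && (a %% w == b)%N].
  have PI d a : reach d a -> (a %% w = b)%N -> P d.
    move=> rd ra; have le := reach_le rd; rewrite -ltnS in le.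
    by apply/existsP; exists (Ordinal le); rewrite /= rd ra eqxx.
  have exP : exists d, P d by have [a ra ma] := cover b; exists r; exact: PI ma.
  case: (ex_minnP exP) => d /existsP[a /andP[/reachP[nu hd ha] /eqP ma]] min.
  exists nu; split; first by rewrite ha.
  by move=> d' a' rd' ma'; rewrite hd; apply: min; exact: PI ma'.
have muR (b : 'I_w) : reach (mdeg (mu b)) (weight g (mu b)).1 by apply/reachP; exists (mu b).
have struct d a (b : 'I_w) : reach d a -> (a %% w = b)%N -> exists p q,
    (a = q * w + (weight g (mu b)).1)%N /\ (d = p + q + mdeg (mu b))%N.
  move=> rd ma; have [mb minb] := hmu b; have le := minb _ _ rd ma.
  have [lea|lta] := leqP (weight g (mu b)).1 a.
    have [q qE] : exists q, a = ((weight g (mu b)).1 + q * w)%N.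
      exists ((a - (weight g (mu b)).1) %/ w)%N.
      by rewrite divnK ?subnKC // -eqn_mod_dvd // ma mb.
    have [led|ltd] := leqP (mdeg (mu b) + q) d.
      by exists (d - (mdeg (mu b) + q))%N, q; split; lia.
    rewrite qE in rd; have /andP[d0 rc] := reach_descent (muR b) rd ltd.
    by have := minb _ _ rc mb; lia.
  have [q qE] : exists q, (weight g (mu b)).1 = (a + q.+1 * w)%N.
    have dv : (w %| (weight g (mu b)).1 - a)%N.
      by rewrite -eqn_mod_dvd ?ma ?mb // ltnW.
    by case/dvdnP: dv => -[|q] hq; [lia | exists q; lia].
  have muR' := muR b; rewrite qE in muR'.
  elim: d rd le => [|d IH] rd le.
    have lt : (mdeg (mu b) < 0 + q.+1)%N by lia.
    by have := reach_descent rd muR' lt.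
  have lt : (mdeg (mu b) < d.+1 + q.+1)%N by lia.
  have /andP[_ rd'] := reach_descent rd muR' lt.
  have [p [q' [e1 e2]]] := IH rd' (minb _ _ rd' ma).
  by exists p.+1, q'; split; lia.
have /fin_all_exists[f hf] : forall jb : 'I_N * 'I_w, exists t : 'I_w * (nat * nat),
    ((g jb.1).1 + (weight g (mu jb.2)).1 =
       t.2.2 * w + (weight g (mu t.1)).1)%N /\
    (1 + mdeg (mu jb.2) = t.2.1 + t.2.2 + mdeg (mu t.1))%N.
  move=> [j b] /=; have rd := reachD (reach1 j) (muR b).
  have [p [q [h1 h2]]] := @struct _ _ (Ordinal (ltn_pmod _ w_gt0)) rd erefl.
  by exists (Ordinal (ltn_pmod ((g j).1 + (weight g (mu b)).1) w_gt0), (p, q)).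
have h1 b : (mdeg (mu b) <= r)%N.
  by have [a ra ma] := cover b; case: (hmu b) => _ /(_ _ _ ra ma).
exists mu, (fun j b => (f (j, b)).1), (fun j b => (f (j, b)).2.1),
  (fun j b => (f (j, b)).2.2), (Ordinal w_gt0); split=> //.
- split=> // [b|j b|j b]; first by case: (hmu b).
    by case: (hf (j, b)).
  have [e1 e2] := hf (j, b); move: e1 e2 => /= e1 e2.
  have := weight_mdeg (mu b) gw; have := weight_mdeg (mu (f (j, b)).1) gw.
  have := gw j; have := congr1 (muln^~ w) e2; rewrite /= !mulnDl mul1n.
  move: e1; rewrite -![(\sum_l _ * _)%N]/((weight g _).1).
  rewrite -![(\sum_l (g l).2 * _)%N]/((weight g _).2).
  lia.
- case: (hmu (Ordinal w_gt0)) => _ /(_ _ _ reach0 (mod0n _)).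
  by rewrite leqn0 mdeg_eq0 => /eqP.
- have [b hb] := attained; exists b; apply/eqP; rewrite eqn_leq h1 /= leqNgt.
  apply/negP => lt; have [mb _] := hmu b.
  have := hb _ (reach_mono (muR b) _); rewrite mb eqxx.
  by move=> /(_ ltac:(lia)).
Qed.

End AperyExists.
(** * Regularity as a covering number *)
Section SumsetBridge.
Variables (e m n : nat).
Hypotheses (m_ge1 : (1 <= m)%N) (m_lt_n : (m < n)%N) (n_le : (n <= e - 2)%N).
Local Notation w := (2 * e - 1)%N.
Local Notation g := (@gen_exp e m n).
Local Notation N := (size (Sbar_gens e m n)).

Definition is_gen (a : nat) : bool :=
  (a == 0)%N || [&& e <= a, a < 2 * e, a != e + m & a != e + n]%N.

Lemma gen_exp_surj x : x \in Sbar_gens e m n -> exists l, g l = x.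
Proof.
by move=> h; have /tnthP[l ->] : x \in in_tuple (Sbar_gens e m n) := h; exists l.
Qed.

Lemma is_genE a : is_gen a = (a \in [seq x.1 | x <- Sbar_gens e m n]).
Proof.
rewrite map_rcons -map_comp mem_rcons inE /is_gen; congr (_ || _).
apply/idP/mapP => [/and4P[h1 h2 h3 h4]|[i]].
  exists (a - e)%N; last by rewrite /= subnKC.
  by rewrite mem_filter mem_iota; lia.
by rewrite mem_filter mem_iota => h -> /=; lia.
Qed.

Lemma is_genP a : reflect (exists l, (g l).1 = a) (is_gen a).
Proof.
rewrite is_genE; apply: (iffP mapP) => [[x /gen_exp_surj[l <-] ->]|[l <-]].
  by exists l.
by exists (g l) => //; exact: mem_tnth.
Qed.

Let e_gt0 : (0 < e)%N. Proof. lia. Qed.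
Let gw l : ((g l).1 + (g l).2 = w)%N. Proof. exact: gen_exp_mdeg. Qed.

Lemma reachSP d a :
  reflect (exists b c, [/\ a = (b + c)%N, is_gen b & reach g d c]) (reach g d.+1 a).
Proof.
apply: (iffP idP) => [/reachP[mu hd ha]|[b [c [-> /is_genP[l <-] rc]]]]; last first.
  by rewrite -add1n; apply: reachD => //; exact: reach1.
have [l hl] : exists l, mu l != 0%N.
  by apply: mnm_neq0; rewrite -mdeg_eq0 hd.
have muE : mu = (U_(l) + (mu - U_(l)))%MM by rewrite addmC submK // lep1mP.
exists (g l).1, (weight g (mu - U_(l))%MM).1; split; last first.
- apply/reachP; exists (mu - U_(l))%MM => //; apply/eqP.
  by rewrite -(eqn_add2l 1) -{1}(mdeg1 l) -mdegD -muE hd.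
- by apply/is_genP; exists l.
rewrite -ha {1}muE /=; under eq_bigr do rewrite mnmDE mulnDr.
rewrite big_split /=; congr (_ + _)%N; rewrite (bigD1 l) //= mnm1E eqxx muln1.
by rewrite big1 ?addn0 // => k ne; rewrite mnm1E eq_sym (negPf ne) muln0.
Qed.

Lemma reach0P a : reach g 0 a = (a == 0)%N.
Proof.
apply/idP/eqP => [r0|->]; last exact: reach0.
by have := reach_le gw r0; rewrite mul0n; lia.
Qed.

Lemma reach1P a : reach g 1 a = is_gen a.
Proof.
apply/reachSP/idP => [[b [c [-> hb]]]|h]; first by rewrite reach0P => /eqP ->; rewrite addn0.
by exists a, 0%N; split; rewrite ?addn0 ?reach0P.
Qed.

Lemma reach2P a :
  reflect (exists b c, [/\ a = (b + c)%N, is_gen b & is_gen c]) (reach g 2 a).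
Proof.
by apply: (iffP (reachSP _ _)) => -[b [c [h1 h2 h3]]]; exists b, c; rewrite reach1P in h3 *.
Qed.

Fixpoint sumset (s : seq nat) d : seq nat :=
  if d is d'.+1 then undup [seq (x + y)%N | x <- s, y <- sumset s d'] else [:: 0%N].

Lemma reach_sumset d a :
  reach g d a = (a \in sumset [seq x.1 | x <- Sbar_gens e m n] d).
Proof.
elim: d a => [|d IH] a; first by rewrite reach0P inE.
rewrite /= mem_undup; apply/reachSP/allpairsP => [[b [c [-> hb hc]]]|[[b c] /= [hb hc ->]]].
  by exists (b, c); rewrite -is_genE -IH.
by exists b, c; rewrite is_genE IH.
Qed.

Variable K : fieldType.
Hypothesis CM : Cohen_Macaulay (Sbar_ring K e m n).

Lemma gen_exp_y : exists y, g y = (0, w)%N.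
Proof.
by apply: gen_exp_surj; rewrite mem_rcons mem_head.
Qed.

Lemma gen_exp_z : exists z, g z = (w, 0)%N.
Proof.
apply: gen_exp_surj; rewrite mem_rcons inE; apply/orP; right.
apply/mapP; exists (e - 1)%N; last by congr (_, _); lia.
by rewrite mem_filter mem_iota; lia.
Qed.

Lemma reach_closed d a :
  (forall l, reach g d.+1 ((g l).1 + a)) -> reach g d a.
Proof.
move=> h; have [z hz] := gen_exp_z; have [y hy] := gen_exp_y.
have lea : (a <= d * w)%N.
  by have := reach_le gw (h z); rewrite hz mulSn leq_add2l.
have w0 : (0 < w)%N by lia.
have [mu hmu] : Sbar_mem e m n (a, d * w - a)%N.
  apply: (Sbar_closed_of_CM e_gt0 CM) => [||l]; [by exists y|by exists z|].
  have /reachP[nu hd ha] := h l; exists nu.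
  have := weight_mdeg nu gw; rewrite hd ha mulSn; have := gw l.
  rewrite [weight g nu]surjective_pairing ha /=.
  move: lea; move: (d * w)%N (\sum_l _)%N => dw x lea h1 h2.
  by congr (_, _); lia.
apply/reachP; exists mu; last by rewrite hmu.
apply/eqP; rewrite -(eqn_pmul2r w0) -(weight_mdeg mu gw) hmu /=.
by rewrite subnKC.
Qed.

Lemma regularity_of_residues r : (0 < r)%N ->
  (forall b, (b < w)%N -> exists2 a, reach g r a & (a %% w = b)%N) ->
  (exists2 b, (b < w)%N & forall a, reach g r.-1 a -> (a %% w)%N != b) ->
  has_regularity (@Sbar_piece K e m n) r%:Z.
Proof.
move=> r0 cover [b bw attained].
have [y hy] := gen_exp_y; have [z hz] := gen_exp_z.
have w0 : (0 < w)%N by lia.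
have cover' (c : 'I_w) : exists2 a, reach g r a & (a %% w = c)%N by exact: cover.
have attained' : exists c : 'I_w, forall a, reach g r.-1 a -> (a %% w)%N != c.
  by exists (Ordinal bw).
have [mu [tgt [p [q [b0 [ap mu0 le_r ex_r]]]]]] :=
  apery_basis_exists w0 gw hy hz reach_closed cover' attained' r0.
exact: (Sbar_regularity K ap mu0 le_r ex_r).
Qed.

Lemma regularity_compute r : (0 < r)%N ->
  let S d := [seq (a %% w)%N | a <- sumset [seq x.1 | x <- Sbar_gens e m n] d] in
  all (fun b => b \in S r) (iota 0 w) ->
  has (fun b => b \notin S r.-1) (iota 0 w) ->
  has_regularity (@Sbar_piece K e m n) r%:Z.
Proof.
move=> r0 S /allP cov /hasP[b]; rewrite mem_iota add0n => /andP[_ bw] nb.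
apply: regularity_of_residues => //.
  move=> c cw; have /mapP[a ha ->] : c \in S r by apply: cov; rewrite mem_iota.
  by exists a => //; rewrite reach_sumset.
exists b => // a ra; apply: contra nb => /eqP <-; apply: map_f.
by rewrite -reach_sumset.
Qed.

End SumsetBridge.
(** * Covering numbers for e at least 7 *)
Section LargeEmbeddingDimension.
Variables (e m n : nat).
Hypotheses (m_ge1 : (1 <= m)%N) (m_lt_n : (m < n)%N) (n_le : (n <= e - 2)%N).
Hypothesis e_ge7 : (7 <= e)%N.
Local Notation w := (2 * e - 1)%N.
Local Notation reach := (reach (@gen_exp e m n)).

Definition gen_idx i := [&& i < e, i != m & i != n]%N.

Lemma is_gen_idx i : gen_idx i -> is_gen e m n (e + i).
Proof. by rewrite /is_gen /gen_idx; lia. Qed.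

Lemma gen_idx0 : gen_idx 0. Proof. by rewrite /gen_idx; lia. Qed.

(** The pairs {0,k}, {1,k-1}, {2,k-2} are disjoint for k >= 4, so m and n cannot
    spoil all three. *)
Lemma low_sum k : (k <= e - 1)%N ->
  (4 <= k)%N \/ [/\ m != 1, (m, n) != (2, 3) & k <= 3]%N ->
  exists i j, [/\ k = (i + j)%N, gen_idx i & gen_idx j].
Proof.
move=> ke hk; rewrite /gen_idx.
have [h|h] := boolP ((k == m) || (k == n)); last first.
  by exists 0%N, k; split; lia.
have [k4|k4] := leqP 4 k; last first.
  case: hk => [|[m1 mn k3]]; first by lia.
  have {}mn : ~ (m = 2 /\ n = 3)%N by case=> m2 n3; rewrite m2 n3 in mn.
  by exists 1%N, (k - 1)%N; split; lia.
have [h1|h1] := boolP [|| 1 == m, 1 == n, k - 1 == m | k - 1 == n]%N; last first.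
  by exists 1%N, (k - 1)%N; split; lia.
by exists 2%N, (k - 2)%N; split; lia.
Qed.

(** The mirror image of [low_sum], counting down from e-1. *)
Lemma high_sum k : (4 <= k <= e - 1)%N ->
  exists i j, [/\ i + j + k = 2 * e - 2, gen_idx i & gen_idx j]%N.
Proof.
move=> /andP[k4 ke]; rewrite /gen_idx.
have [h|h] := boolP ((e - 1 - k == m) || (e - 1 - k == n))%N; last first.
  by exists (e - 1)%N, (e - 1 - k)%N; split; lia.
have [h1|h1] := boolP [|| e - 2 == m, e - 2 == n, e - k == m | e - k == n]%N; last first.
  by exists (e - 2)%N, (e - k)%N; split; lia.
by exists (e - 3)%N, (e + 1 - k)%N; split; lia.
Qed.

Lemma modw q b : (b < w)%N -> ((q * w + b) %% w = b)%N.
Proof. by move=> bw; rewrite modnMDl modn_small. Qed.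

Lemma modwE a b : (a %% w)%N = b ->
  [\/ a = b, a = (w + b)%N | (2 * w + b <= a)%N].
Proof.
move=> ab; have := divn_eq a w; rewrite ab; case: (a %/ w)%N => [|[|q]].
- by rewrite mul0n => ->; constructor 1.
- by rewrite mul1n => ->; constructor 2.
- by rewrite !mulSn => ->; constructor 3; move: (q * w)%N => t; lia.
Qed.

Let reach2 a b : is_gen e m n a -> is_gen e m n b -> reach 2 (a + b).
Proof. by move=> ha hb; apply/reach2P => //; exists a, b. Qed.

Let reach3 a b c : is_gen e m n a -> is_gen e m n b -> is_gen e m n c ->
  reach 3 (a + (b + c)).
Proof.
by move=> ha hb hc; apply/reachSP => //; exists a, (b + c)%N; split => //; exact: reach2.
Qed.

Let is_gen0 : is_gen e m n 0. Proof. by []. Qed.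

(** Residues below e are 2e + k modulo w for small k, where [low_sum] applies; the
    two missing residues e+m and e+n are reached from the top of the range, by
    [high_sum] unless n is close to e-1. *)
Lemma cover2 : m != 1%N -> (m, n) != (2, 3)%N -> (n <= e - 3)%N ->
  (m, n) != (e - 4, e - 3)%N ->
  forall b, (b < w)%N -> exists2 a, reach 2 a & (a %% w = b)%N.
Proof.
move=> m1 mn23 n3 mn43 b bw.
have {}mn43 : ~ (m = e - 4 /\ n = e - 3)%N by case=> h1 h2; rewrite h1 h2 eqxx in mn43.
have wit i j : gen_idx i -> gen_idx j -> (2 * e + i + j = w + b)%N ->
    exists2 a, reach 2 a & (a %% w = b)%N.
  move=> hi hj hb; exists ((e + i) + (e + j))%N; first by apply: reach2; exact: is_gen_idx.
  have -> : (e + i + (e + j) = 1 * w + b)%N by lia.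
  exact: modw.
have [b0|b0] := posnP b; first by exists 0%N; [exact: (reach2 is_gen0 is_gen0) | rewrite mod0n].
have [be|be] := ltnP b e.
  have [||i [j [hk hi hj]]] := @low_sum (b - 1); first by lia.
    by have [k4|k4] := leqP 4 (b - 1); [left | right; split=> //; lia].
  by apply: (wit i j) => //; lia.
have [bi|bi] := boolP (gen_idx (b - e)).
  exists b; last exact: modn_small.
  by have := reach2 is_gen0 (is_gen_idx bi); rewrite add0n subnKC.
have [bm|bm] := eqVneq b (e + m)%N.
  have [|i [j [hk hi hj]]] := @high_sum (e - 1 - m); first by lia.
  by apply: (wit i j) => //; lia.
have bn : b = (e + n)%N by move: bi; rewrite /gen_idx; lia.
have [k4|k4] := leqP 4 (e - 1 - n).
  have [|i [j [hk hi hj]]] := @high_sum (e - 1 - n); first by lia.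
  by apply: (wit i j) => //; lia.
have [n4|n4] := eqVneq n (e - 3)%N.
  by apply: (wit (e - 2) (e - 2))%N; rewrite /gen_idx; lia.
by apply: (wit (e - 2) (e - 3))%N; rewrite /gen_idx; lia.
Qed.

(** A residue b = 2, 3, 4, for which two summands may not suffice, is
    3e + (e-1) + (b-1) modulo w, and one of b-1, b, b+1 is an admissible first
    index.  The residue e+m is 3e + (m-1) modulo w; so is e+n with
    n-1, which is admissible unless n-1 = m. *)
Lemma cover3 : forall b, (b < w)%N -> exists2 a, reach 3 a & (a %% w = b)%N.
Proof.
move=> b bw.
have wit q x y z : is_gen e m n x -> is_gen e m n y -> is_gen e m n z ->
    (x + (y + z) = q * w + b)%N -> exists2 a, reach 3 a & (a %% w = b)%N.
  move=> hx hy hz hb; exists (x + (y + z))%N; first exact: reach3.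
  by rewrite hb; exact: modw.
have [b0|b0] := posnP b; first by apply: (wit 0 0 0 0)%N; rewrite // b0.
have [be|be] := ltnP b e.
  have [b1|b1] := eqVneq b 1%N.
    by apply: (wit 1 0 (e + 0) (e + 0))%N => //; try exact: is_gen_idx gen_idx0; lia.
  have [k4|k4] := leqP 4 (b - 1).
    have [||i [j [hk hi hj]]] := @low_sum (b - 1); [by lia | by left |].
    by apply: (wit 1 0 (e + i) (e + j))%N => //; try exact: is_gen_idx; lia.
  have [x [x1 x2 hx]] : exists x, [/\ b - 1 <= x, x <= b + 1 & gen_idx x]%N.
    have [h|h] := boolP (gen_idx (b - 1)); first by exists (b - 1)%N; split=> //; lia.
    have [h1|h1] := boolP (gen_idx b); first by exists b; split=> //; lia.
    by exists (b + 1)%N; split; move: h h1; rewrite /gen_idx; lia.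
  have [||i [j [hk hi hj]]] := @low_sum (e - 1 + (b - 1) - x); [by lia | by left; lia |].
  by apply: (wit 2 (e + x) (e + i) (e + j))%N => //; try exact: is_gen_idx; lia.
have [bi|bi] := boolP (gen_idx (b - e)).
  by apply: (wit 0 0 0 (e + (b - e)))%N => //; [exact: is_gen_idx | lia].
have [bm|bm] := eqVneq b (e + m)%N.
  apply: (wit 1 (e + (m - 1)) (e + 0) (e + 0))%N; try exact: is_gen_idx gen_idx0; last by lia.
  by apply: is_gen_idx; rewrite /gen_idx; lia.
have bn : b = (e + n)%N by move: bi; rewrite /gen_idx; lia.
have [nm|nm] := eqVneq (n - 1)%N m; last first.
  apply: (wit 1 (e + (n - 1)) (e + 0) (e + 0))%N; try exact: is_gen_idx gen_idx0; last by lia.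
  by apply: is_gen_idx; rewrite /gen_idx; lia.
have [m1|m1] := eqVneq m 1%N.
  have [|i [j [hk hi hj]]] := @high_sum (e - 1 - n); first by lia.
  by apply: (wit 1 0 (e + i) (e + j))%N => //; try exact: is_gen_idx; lia.
apply: (wit 1 (e + (m - 1)) (e + 1) (e + 0))%N; try exact: is_gen_idx gen_idx0; last by lia.
  by apply: is_gen_idx; rewrite /gen_idx; lia.
by apply: is_gen_idx; rewrite /gen_idx; lia.
Qed.

Lemma not_cover1 : exists2 b, (b < w)%N & forall a, reach 1 a -> (a %% w)%N != b.
Proof.
exists 1%N; first by lia.
move=> a; rewrite reach1P // /is_gen => ga; apply/eqP => /modwE; case; lia.
Qed.

(** The uncovered residue comes from an index sum with too few decompositions: 1
    if m = 1, 3 if (m, n) = (2, 3), and 2e-3 if n = e-2. *)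
Lemma not_cover2 : (m = 1 \/ m = 2 /\ n = 3 \/ n = e - 2)%N ->
  exists2 b, (b < w)%N & forall a, reach 2 a -> (a %% w)%N != b.
Proof.
move=> hmn; exists (if n == e - 2 then 2 * e - 2 else if m == 1 then 2 else 4)%N.
  by do 2?[case: ifP]; lia.
move=> a /reach2P[]// b [c [-> gb gc]]; apply/eqP => /modwE.
move: gb gc; rewrite /is_gen; case: (eqVneq n (e - 2)%N) => [h|h].
  by move=> gb gc; case; lia.
by case: (eqVneq m 1%N) => [h1|h1] gb gc; case; lia.
Qed.

Variable K : fieldType.
Hypothesis CM : Cohen_Macaulay (Sbar_ring K e m n).

(** If (m, n) = (e-4, e-3), then 4e-5 is a gap in degree 2: it could only be the
    sum of the generators of indices e-1 and e-4, or e-2 and e-3. *)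
Lemma CM_excludes : (m, n) != (e - 4, e - 3)%N.
Proof.
apply/eqP => -[hm hn].
have r1 : reach 3 (4 * e - 5).
  have -> : (4 * e - 5 = (e + (e - 5)) + ((e + 0) + (e + 0)))%N by lia.
  by apply: reach3; apply: is_gen_idx; rewrite /gen_idx; lia.
have r2 : reach 3 (4 * e - 5 + w).
  have -> : (4 * e - 5 + w = (e + (e - 2)) + ((e + (e - 2)) + (e + (e - 2))))%N by lia.
  by apply: reach3; apply: is_gen_idx; rewrite /gen_idx; lia.
have [y hy] := gen_exp_y e m n; have [z hz] := gen_exp_z m_ge1 m_lt_n n_le.
have gw l : ((@gen_exp e m n l).1 + (@gen_exp e m n l).2 = w)%N by apply: gen_exp_mdeg; lia.
have w0 : (0 < w)%N by lia.
have := reach_corner w0 gw hy hz (reach_closed m_ge1 m_lt_n n_le CM) r1 r2.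
by case/reach2P => // b [c [hbc]]; rewrite /is_gen; lia.
Qed.

Lemma regularity_large3 : (m = 1 \/ m = 2 /\ n = 3 \/ n = e - 2)%N ->
  has_regularity (@Sbar_piece K e m n) 3.
Proof.
move=> h; apply: (@regularity_of_residues e m n _ _ _ K CM 3) => //.
  exact: cover3.
exact: not_cover2.
Qed.

Lemma regularity_large2 : m != 1%N -> (m, n) != (2, 3)%N -> (n <= e - 3)%N ->
  has_regularity (@Sbar_piece K e m n) 2.
Proof.
move=> m1 mn n3; apply: (@regularity_of_residues e m n _ _ _ K CM 2) => //.
  by apply: cover2 => //; exact: CM_excludes.
exact: not_cover1.
Qed.

End LargeEmbeddingDimension.

Theorem theorem4p11 (K : closedFieldType) (char0 : [pchar K] =i pred0)
    (e m n : nat) (m_ge1 : (1 <= m)%N) (m_lt_n : (m < n)%N)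
    (n_le : (n <= e - 2)%N)
    (CM : Cohen_Macaulay (Sbar_ring K e m n)) :
  has_regularity (@Sbar_piece K e m n)
    (if (e, m, n) == (4, 1, 2)%N then 6
     else if (e, m, n) \in [:: (5, 1, 2); (5, 1, 3); (5, 2, 3)]%N then 4
     else if (6 <= e)%N && (m == 1)%N then 3
     else if (6 <= e)%N &&
             ((m, n) \in [:: (2, 3); (e - 3, e - 2); (e - 4, e - 2)]%N) then 3
     else if [&& 6 <= e, n == e - 2, 2 <= m & m <= e - 5]%N then 3
     else 2).
Proof.
have [e7|e6] := leqP 7 e.
  have r3 := regularity_large3 m_ge1 m_lt_n n_le e7 CM.
  have r2 := regularity_large2 m_ge1 m_lt_n n_le e7 CM.
  rewrite !inE !xpair_eqE.
  case: ifPn => [|_]; first by lia.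
  case: ifPn => [|_]; first by lia.
  case: ifPn => [h|h1]; first by apply: r3; lia.
  case: ifPn => [h|h2]; first by apply: r3; lia.
  case: ifPn => [h|h3]; first by apply: r3; lia.
  by apply: r2; rewrite ?xpair_eqE; lia.
have : (e, m, n) \in [:: (4, 1, 2); (5, 1, 2); (5, 1, 3); (5, 2, 3);
    (6, 1, 2); (6, 1, 3); (6, 1, 4); (6, 2, 3); (6, 2, 4); (6, 3, 4)]%N.
  clear CM; move: e m n m_ge1 m_lt_n n_le e6.
  case=> [|[|[|[|[|[|[|?]]]]]]] [|[|[|[|[|?]]]]] [|[|[|[|[|?]]]]] //; lia.
have compute := regularity_compute m_ge1 m_lt_n n_le CM.
rewrite !inE => /or4P[/eqP[??? ]|/eqP[???]|/eqP[???]|]; subst.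
- exact: (compute 6 isT isT isT).
- exact: (compute 4 isT isT isT).
- exact: (compute 4 isT isT isT).
case/or4P => [/eqP[??? ]|/eqP[???]|/eqP[???]|]; subst.
- exact: (compute 4 isT isT isT).
- exact: (compute 3 isT isT isT).
- exact: (compute 3 isT isT isT).
case/or4P => /eqP[???]; subst.
- exact: (compute 3 isT isT isT).
- exact: (compute 3 isT isT isT).
- exact: (compute 3 isT isT isT).
- exact: (compute 3 isT isT isT).
Qed.
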